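(* There is an algorithm that, given a semi-equational non-duplicating LR-separated CTRS $\mathcal{R}$, decides whether the following condition holds: for every conditional critical pair $\Gamma\Rightarrow\langle s,t\rangle$ of $\mathcal{R}$ (with $\Gamma$ regarded as a multiset of equations), at least one of (i) $\Gamma\Vdash_{\mathcal{R}}s\sim_0t$ or $\Gamma\Vdash_{\mathcal{R}}s\sim_1t$; (ii) $\Gamma\Vdash_{\mathcal{R}}s\to_2t$ or $\Gamma\Vdash_{\mathcal{R}}t\to_2s$; (iii) $\Gamma\Vdash_{\mathcal{R}}s\to_i\circ\sim_jt$ for some $i,j$ with $i+j\le2$ and $\Gamma\Vdash_{\mathcal{R}}t\to_{i'}\circ\sim_{j'}s$ for some $i',j'$ with $i'+j'\le2$.
   Context: An LR-separated conditional rewrite rule is $l\to r\Leftarrow x_1\approx y_1,\dots,x_n\approx y_n$ where $l$ is a linear non-variable term, $\mathcal{V}(l)=\{x_1,\dots,x_n\}$, $\mathcal{V}(r)\subseteq\{y_1,\dots,y_n\}$, $\{x_i\}\cap\{y_i\}=\emptyset$, the $x_i$ are pairwise distinct (the $y_i$ need not be). It is non-duplicating if for every $y\in\mathcal{V}(r)$ the number of occurrences of $y$ in $r$ is at most the number of occurrences of $y$ in the sequence $y_1,\dots,y_n$. An LR-separated CTRS is a finite set of such rules (semi-equational: conditions are interpreted as convertibility). Conditional critical pairs: for rules $l_1\to r_1\Leftarrow\Gamma_1$, $l_2\to r_2\Leftarrow\Gamma_2$ renamed apart, a non-variable position $p$ of $l_2$ with $\sigma=\mathrm{mgu}(l_1,l_2|_p)$,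 excluding the case $p=\epsilon$ with identical rules, the triple $\Gamma_1\sigma,\Gamma_2\sigma\Rightarrow\langle l_2[r_1]_p\sigma,r_2\sigma\rangle$. For a finite multiset $\Gamma$ of equations, terms and $n\in\mathbb{N}$, the judgements $\Gamma\Vdash_{\mathcal{R}}u\sim_nv$, $\Gamma\Vdash_{\mathcal{R}}u\to_nv$ and $\Gamma\Vdash_{\mathcal{R}}\langle u_1,\dots,u_m\rangle\sim_n\langle v_1,\dots,v_m\rangle$ are the least ones closed under the rules ($\sqcup$ is multiset union): (1) $\Gamma\sqcup\{u\approx v\}\Vdash_{\mathcal{R}}u\sim_0v$; (2) $\Gamma\Vdash_{\mathcal{R}}t\sim_0t$; (3) from $\Gamma\Vdash_{\mathcal{R}}t\sim_is$ infer $\Gamma\Vdash_{\mathcal{R}}s\sim_it$; (4) from $\Gamma\Vdash_{\mathcal{R}}s\sim_it$ and $\Sigma\Vdash_{\mathcal{R}}t\sim_ju$ infer $\Gamma\sqcup\Sigma\Vdash_{\mathcal{R}}s\sim_{i+j}u$; (5) from $\Gamma\Vdash_{\mathcal{R}}s\sim_it$ infer $\Gamma\Vdash_{\mathcal{R}}C[s]\sim_iC[t]$ for any context $C$; (6) from $\Gamma_k\Vdash_{\mathcal{R}}u_k\sim_{i_k}v_k$ ($k=1,\dots,m$) infer $\bigsqcup_k\Gamma_k\Vdash_{\mathcal{R}}\langle u_1,\dots,u_m\rangle\sim_{\sum_ki_k}\langle v_1,\dots,v_m\rangle$; (7) from $\Gamma\Vdash_{\mathcal{R}}s\to_it$ infer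 $\Gamma\Vdash_{\mathcal{R}}s\sim_it$; (8) for $l\to r\Leftarrow u_1\approx v_1,\dots,u_m\approx v_m\in\mathcal{R}$, a substitution $\sigma$ and context $C$: from $\Gamma\Vdash_{\mathcal{R}}\langle u_1\sigma,\dots,u_m\sigma\rangle\sim_i\langle v_1\sigma,\dots,v_m\sigma\rangle$ infer $\Gamma\Vdash_{\mathcal{R}}C[l\sigma]\to_{i+1}C[r\sigma]$. Finally $\Gamma\Vdash_{\mathcal{R}}s\to_i\circ\sim_jt$ means that there are a term $w$ and multisets $\Gamma_1,\Gamma_2$ with $\Gamma=\Gamma_1\sqcup\Gamma_2$, $\Gamma_1\Vdash_{\mathcal{R}}s\to_iw$ and $\Gamma_2\Vdash_{\mathcal{R}}w\sim_jt$. *)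

(* Defs.v *)
From HB Require Import structures.
From mathcomp Require Import all_boot.

Set Implicit Arguments.
Unset Strict Implicit.
Unset Printing Implicit Defensive.

(* Total recursive functions in the sense of Kleene: in [rec_mu], the
   minimisation is regular, i.e. [f] is total, so no partiality is needed. *)
Inductive recursive : forall k : nat, (k.-tuple nat -> nat) -> Prop :=
| rec_zero : @recursive 0 (fun=> 0)
| rec_succ : @recursive 1 (fun v => (thead v).+1)
| rec_proj k (i : 'I_k) : @recursive k (fun v => tnth v i)
| rec_comp m k (h : m.-tuple nat -> nat) (g : 'I_m -> k.-tuple nat -> nat) :
    recursive h -> (forall i, recursive (g i)) ->
    @recursive k (fun v => h [tuple g i v | i < m])
| rec_prim k (b : k.-tuple nat -> nat) (s : k.+2.-tuple nat -> nat) :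
    recursive b -> recursive s ->
    @recursive k.+1 (fun v : k.+1.-tuple nat =>
      nat_rec (fun=> nat) (b [tuple of behead v])
        (fun n r => s [tuple of n :: r :: behead v]) (thead v))
| rec_mu k (g : k.+1.-tuple nat -> nat) (f : k.-tuple nat -> nat) :
    recursive g ->
    (forall v, g [tuple of f v :: v] = 0
               /\ forall n, n < f v -> g [tuple of n :: v] <> 0) ->
    recursive f
| rec_ext k (f g : k.-tuple nat -> nat) : f =1 g -> recursive f -> recursive g.

(* A signature is a countable set [F] of function symbols with arities [ar];
   the variables are the natural numbers. *)
Inductive term (F : Type) (ar : F -> nat) : Type :=
| Var of nat
| Fun (f : F) of {ffun 'I_(ar f) -> term ar}.
Arguments Var {F ar}.
Arguments Fun {F ar}.

Fixpoint code_term (F : countType) (ar : F -> nat) (t : term ar) : nat :=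
  match t with
  | Var x => CodeSeq.code [:: 0; x]
  | Fun f a =>
      CodeSeq.code
        (1 :: pickle f :: [seq code_term (a i) | i <- enum 'I_(ar f)])
  end.

Lemma code_term_inj (F : countType) (ar : F -> nat) :
  injective (@code_term F ar).
Proof.
rewrite /injective; fix IH 1 => -[x|f a] [y|g b] /(can_inj CodeSeq.codeK) //.
  by case=> ->.
case=> /(pcan_inj pickleK) fg; case: g / fg b => b ab; congr Fun.
apply/ffunP => i; apply: IH.
by move/eq_in_map: ab; apply; rewrite mem_enum.
Qed.

HB.instance Definition _ (F : countType) (ar : F -> nat) :=
  Equality.copy (term ar) (inj_type (@code_term_inj F ar)).

Section Rewriting.

Variables (F : countType) (ar : F -> nat).
Implicit Types (t u : term ar) (sigma : nat -> term ar).

Fixpoint subst sigma t : term ar :=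
  match t with
  | Var x => sigma x
  | Fun f a => Fun f [ffun i => subst sigma (a i)]
  end.

(* The variable occurrences from left to right, with repetitions. *)
Fixpoint vars t : seq nat :=
  match t with
  | Var x => [:: x]
  | Fun f a => flatten [seq vars (a i) | i <- enum 'I_(ar f)]
  end.

Definition linear t : bool := uniq (vars t).

Definition is_var t : bool := if t is Var _ then true else false.

Inductive ctx : Type :=
| Hole
| CFun (f : F) (i : 'I_(ar f)) of {ffun 'I_(ar f) -> term ar} & ctx.

(* The [i]-th entry of [a] in [CFun f i a C] is overwritten, hence irrelevant. *)
Fixpoint plug (C : ctx) t : term ar :=
  match C with
  | Hole => t
  | CFun f i a D => Fun f [ffun j => if j == i then plug D t else a j]
  end.

(* Positions are sequences of argument indices, counted from 0. *)
Fixpoint subterm_at t (p : seq nat) : option (term ar) :=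
  match p, t with
  | [::], _ => Some t
  | _ :: _, Var _ => None
  | i :: q, Fun f a => if insub i is Some j then subterm_at (a j) q else None
  end.

Fixpoint replace_at t (p : seq nat) u : term ar :=
  match p, t with
  | [::], _ => u
  | _ :: _, Var _ => t
  | i :: q, Fun f a =>
      Fun f [ffun j => if nat_of_ord j == i then replace_at (a j) q u else a j]
  end.

Definition equation : Type := (term ar * term ar)%type.

Record rule : Type := Rule {
  lhs : term ar;
  rhs : term ar;
  conds : seq equation }.

Definition rule_tuple (rho : rule) := (lhs rho, rhs rho, conds rho).
Definition tuple_rule (x : term ar * term ar * seq equation) : rule :=
  Rule x.1.1 x.1.2 x.2.
Lemma rule_tupleK : cancel rule_tuple tuple_rule.
Proof. by case. Qed.
HB.instance Definition _ := Equality.copy rule (can_type rule_tupleK).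

Definition code_equation (e : equation) : nat :=
  CodeSeq.code [:: code_term e.1; code_term e.2].

Definition code_rule (rho : rule) : nat :=
  CodeSeq.code [:: code_term (lhs rho); code_term (rhs rho);
                   CodeSeq.code [seq code_equation e | e <- conds rho]].

(* A finite set of rules is presented by a sequence enumerating it; order and
   repetitions are irrelevant to everything defined below except [code_ctrs]. *)
Definition ctrs : Type := seq rule.

Definition code_ctrs (R : ctrs) : nat :=
  CodeSeq.code [seq code_rule rho | rho <- R].

Definition lr_separated_rule (rho : rule) : Prop :=
  exists xys : seq (nat * nat),
    let xs := unzip1 xys in
    let ys := unzip2 xys in
    [/\ conds rho = [seq (Var xy.1, Var xy.2) | xy <- xys],
        linear (lhs rho) && ~~ is_var (lhs rho),
        vars (lhs rho) =i xs /\ uniq xs,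
        {subset vars (rhs rho) <= ys}
      & forall z, ~~ ((z \in xs) && (z \in ys))].

(* For an LR-separated rule the sequence on the right is y_1, ..., y_n. *)
Definition non_duplicating_rule (rho : rule) : Prop :=
  forall y, y \in vars (rhs rho) ->
    count_mem y (vars (rhs rho))
      <= count_mem y (flatten [seq vars e.2 | e <- conds rho]).

Definition lr_separated (R : ctrs) : Prop :=
  forall rho, rho \in R -> lr_separated_rule rho.

Definition non_duplicating (R : ctrs) : Prop :=
  forall rho, rho \in R -> non_duplicating_rule rho.

Definition subst_eqs sigma (G : seq equation) : seq equation :=
  [seq (subst sigma e.1, subst sigma e.2) | e <- G].

Definition is_mgu sigma t u : Prop :=
  subst sigma t = subst sigma u
  /\ forall tau, subst tau t = subst tau u ->
       exists theta, forall x, tau x = subst theta (sigma x).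

Definition rename (d : nat -> nat) : nat -> term ar := fun x => Var (d x).

Definition rename_rule (d : nat -> nat) (rho : rule) : rule :=
  Rule (subst (rename d) (lhs rho)) (subst (rename d) (rhs rho))
       (subst_eqs (rename d) (conds rho)).

Definition rule_vars (rho : rule) : seq nat :=
  vars (lhs rho) ++ vars (rhs rho)
    ++ flatten [seq vars e.1 ++ vars e.2 | e <- conds rho].

(* [ccp R G s t]: G => <s, t> is a conditional critical pair of R. All choices
   of the renamings and of the mgu are admitted; they yield variants. *)
Inductive ccp (R : ctrs) : seq equation -> term ar -> term ar -> Prop :=
| CCP (rho1 rho2 : rule) (d1 d2 : nat -> nat) (p : seq nat) u sigma :
    rho1 \in R -> rho2 \in R -> injective d1 -> injective d2 ->
    let v1 := rename_rule d1 rho1 in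
    let v2 := rename_rule d2 rho2 in
    (forall z, ~~ ((z \in rule_vars v1) && (z \in rule_vars v2))) ->
    subterm_at (lhs v2) p = Some u -> ~~ is_var u ->
    is_mgu sigma (lhs v1) u ->
    ~ (p = [::] /\ rho1 = rho2) ->
    ccp R (subst_eqs sigma (conds v1) ++ subst_eqs sigma (conds v2))
          (subst sigma (replace_at (lhs v2) p (rhs v1)))
          (subst sigma (rhs v2)).

(* Multisets of equations are sequences up to [perm_eq], multiset union being
   concatenation.
   [conv R G n u v]   : G ||- u ~_n v
   [step R G n u v]   : G ||- u ->_n v
   [convs R G n us vs] : G ||- <us> ~_n <vs>
   The m-ary rule for sequences is [convs_cons] iterated m times from
   [convs_nil]. *)
Inductive conv (R : ctrs) :
  seq equation -> nat -> term ar -> term ar -> Prop :=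
| conv_hyp G G' u v :
    perm_eq G (G' ++ [:: (u, v)]) -> conv R G 0 u v
| conv_refl G t : conv R G 0 t t
| conv_sym G i s t : conv R G i t s -> conv R G i s t
| conv_trans G G1 G2 i j s t u :
    perm_eq G (G1 ++ G2) ->
    conv R G1 i s t -> conv R G2 j t u -> conv R G (i + j) s u
| conv_ctx G i s t (C : ctx) :
    conv R G i s t -> conv R G i (plug C s) (plug C t)
| conv_step G i s t : step R G i s t -> conv R G i s t
with step (R : ctrs) :
  seq equation -> nat -> term ar -> term ar -> Prop :=
| step_rule G i (rho : rule) sigma (C : ctx) :
    rho \in R ->
    convs R G i [seq subst sigma e.1 | e <- conds rho]
                [seq subst sigma e.2 | e <- conds rho] ->
    step R G i.+1 (plug C (subst sigma (lhs rho)))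
                  (plug C (subst sigma (rhs rho)))
with convs (R : ctrs) :
  seq equation -> nat -> seq (term ar) -> seq (term ar) -> Prop :=
| convs_nil : convs R [::] 0 [::] [::]
| convs_cons G G1 G2 i j u v us vs :
    perm_eq G (G1 ++ G2) ->
    conv R G1 i u v -> convs R G2 j us vs ->
    convs R G (i + j) (u :: us) (v :: vs).

Definition step_conv (R : ctrs) (G : seq equation) (i j : nat) s t : Prop :=
  exists w G1 G2,
    [/\ perm_eq G (G1 ++ G2), step R G1 i s w & conv R G2 j w t].

Definition ccp_joinable (R : ctrs) (G : seq equation) s t : Prop :=
  [\/ conv R G 0 s t \/ conv R G 1 s t,
      step R G 2 s t \/ step R G 2 t s
    | (exists i j, i + j <= 2 /\ step_conv R G i j s t)
      /\ (exists i j, i + j <= 2 /\ step_conv R G i j t s)].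

Definition ccp_condition (R : ctrs) : Prop :=
  forall G s t, ccp R G s t -> ccp_joinable R G s t.

End Rewriting.

(* Main.v *)
(* A conversion with counter 0 uses every hypothesis of the multiset at most once
   and no rule, so only finitely many terms are reachable by it from a given one.
   In all three conditions both ends are given and at most two rules are applied,
   so every rule application can be reached from an end where its left-hand side
   is met first: matching fixes the variables x_i, and each y_i is reachable from
   x_i. The exception is the outer step of a nested pair, where the condition
   x_i ~_1 y_i cannot be searched from x_i; but there the reduct is known as well,
   which fixes y_i if it occurs in the right-hand side, and if y_i occurs neither
   there nor in another condition, y_i := x_i makes the condition trivial.
   Losing a step only lowers the counter, which condition (i) absorbs.

   One renaming apart and one most general unifier per overlap suffice, because
   the judgements are closed under substitution and all other critical pairs are
   instances of the chosen one. Unification is structural because left-hand sides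
   are linear.

   All terms are embedded into one type of trees, independently of the signature,
   so that a single recursive function serves all signatures. *)

Require Import Defs.
From mathcomp Require Import all_boot.
From mathcomp Require Import zify.

Set Implicit Arguments.
Unset Strict Implicit.
Unset Printing Implicit Defensive.

(** * Recursive functions *)

Definition rec1 (f : nat -> nat) : Prop :=
  recursive (fun v : 1.-tuple nat => f (tnth v ord0)).
Definition rec2 (f : nat -> nat -> nat) : Prop :=
  recursive (fun v : 2.-tuple nat => f (tnth v ord0) (tnth v (inord 1))).
Definition rec3 (f : nat -> nat -> nat -> nat) : Prop :=
  recursive (fun v : 3.-tuple nat =>
    f (tnth v ord0) (tnth v (inord 1)) (tnth v (inord 2))).

Lemma recursive_comp1 k f (g : k.-tuple nat -> nat) :
  rec1 f -> recursive g -> recursive (fun v => f (g v)).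
Proof.
move=> hf hg; apply: (rec_ext (f := fun v => f (tnth [tuple g v | i < 1] ord0))).
  by move=> v; rewrite tnth_mktuple.
exact: (@rec_comp 1 k _ (fun _ => g) hf (fun _ => hg)).
Qed.

Lemma recursive_comp2 k f (g1 g2 : k.-tuple nat -> nat) :
  rec2 f -> recursive g1 -> recursive g2 -> recursive (fun v => f (g1 v) (g2 v)).
Proof.
move=> hf h1 h2; pose g (i : 'I_2) := if i == ord0 then g1 else g2.
have hg i : recursive (g i) by rewrite /g; case: ifP.
apply: rec_ext (rec_comp hf hg) => v.
by rewrite !tnth_mktuple /g /= -!val_eqE /= inordK.
Qed.

Lemma recursive_const k c : recursive (fun _ : k.-tuple nat => c).
Proof.
have rec1S : rec1 S := rec_succ.
elim: c => [|c IHc]; last exact: (recursive_comp1 rec1S IHc).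
by apply: rec_ext (@rec_comp 0 k _ (fun i => fun _ => 0) rec_zero _) => // -[].
Qed.

Lemma rec1_id : rec1 id. Proof. exact: rec_proj. Qed.
Lemma rec1_succ : rec1 S.
Proof. exact: rec_succ. Qed.

Lemma rec2_prim b s : rec1 b -> rec3 s ->
  rec2 (fun n a => nat_rec (fun=> nat) (b a) (fun n r => s n r a) n).
Proof.
move=> hb hs; apply: rec_ext (rec_prim hb hs) => v.
have nv1 : nth 0 (behead v) 0 = tnth v (inord 1).
  by rewrite nth_behead (tnth_nth 0) inordK.
have -> : tnth [tuple of behead v] ord0 = tnth v (inord 1) by rewrite (tnth_nth 0).
rewrite /thead; elim: (tnth v ord0) => //= n ->.
by congr (s _ _ _); rewrite (tnth_nth 0) /= ?inordK.
Qed.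

Lemma rec2_swap f : rec2 f -> rec2 (fun x y => f y x).
Proof. by move=> hf; apply: (recursive_comp2 hf); apply: rec_proj. Qed.

Lemma rec2_ext f g : f =2 g -> rec2 f -> rec2 g.
Proof. by move=> fg; apply: rec_ext => v; rewrite fg. Qed.
Lemma rec1_ext f g : f =1 g -> rec1 f -> rec1 g.
Proof. by move=> fg; apply: rec_ext => v; rewrite fg. Qed.

Ltac rproj := exact: rec_proj.

Lemma rec1_prim c s : rec2 s ->
  rec1 (nat_rec (fun=> nat) c (fun n r => s n r)).
Proof.
move=> hs; have h3 : rec3 (fun n r _ => s n r) by apply: recursive_comp2 => //; rproj.
have := recursive_comp2 (rec2_prim (recursive_const 1 c) h3) rec1_id rec1_id.
by [].
Qed.

Lemma rec2_iter f : rec1 f -> rec2 (fun n a => iter n f a).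
Proof.
move=> hf; have h3 : rec3 (fun _ r _ => f r) by apply: recursive_comp1 => //; rproj.
by apply: rec2_ext (rec2_prim rec1_id h3) => n a; elim: n => //= n ->.
Qed.

Lemma rec2_add : rec2 addn.
Proof.
by apply: rec2_ext (rec2_iter rec1_succ) => n a; rewrite iter_succn addnC.
Qed.

Lemma rec2_mul : rec2 muln.
Proof.
have h3 : rec3 (fun _ r a => a + r) by apply: (recursive_comp2 rec2_add); rproj.
apply: rec2_ext (rec2_prim (recursive_const 1 0) h3) => n a.
by elim: n => //= n ->; rewrite mulSn.
Qed.

Lemma rec1_pred : rec1 predn.
Proof.
have h : rec2 (fun n _ => n) by rproj.
by apply: rec1_ext (rec1_prim 0 h); case.
Qed.

Lemma rec2_sub : rec2 subn.
Proof.
by apply: rec2_swap; apply: rec2_ext (rec2_iter rec1_pred) => n a; rewrite iter_predn.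
Qed.

Lemma rec1_not : rec1 (fun n => n == 0).
Proof.
have h : rec2 (fun n _ => 0) by apply: recursive_const.
by apply: rec1_ext (rec1_prim 1 h); case.
Qed.

Lemma rec1_odd : rec1 (fun n => odd n).
Proof.
have h : rec2 (fun _ r => r == 0) by apply: (recursive_comp1 rec1_not); rproj.
by apply: rec1_ext (rec1_prim 0 h); elim=> //= n ->; case: odd.
Qed.

Lemma rec1_half : rec1 half.
Proof.
have h : rec2 (fun n r => odd n + r).
  apply: (recursive_comp2 rec2_add); last by rproj.
  by apply: (recursive_comp1 rec1_odd); rproj.
apply: rec1_ext (rec1_prim 0 h); elim=> //= n ->.
by rewrite uphalf_half.
Qed.

Lemma rec1_pow2 : rec1 (fun n => 2 ^ n).
Proof.
have h : rec2 (fun _ r => 2 * r).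
  by apply: (recursive_comp2 rec2_mul); [exact: recursive_const | rproj].
by apply: rec1_ext (rec1_prim 1 h); elim=> //= n ->; rewrite expnS.
Qed.

(* [P x y] is the code of the list with head [x] and tail coded by [y], so
   every natural number is either [0] or a unique [P x y]. *)
Definition P (x y : nat) : nat := 2 ^ x * y.*2.+1.
Definition hd (n : nat) : nat := head 0 (CodeSeq.decode n).
Definition tl (n : nat) : nat := CodeSeq.code (behead (CodeSeq.decode n)).

Lemma code_P x s : CodeSeq.code (x :: s) = P x (CodeSeq.code s). Proof. by []. Qed.
Lemma P_code x y : P x y = CodeSeq.code (x :: CodeSeq.decode y).
Proof. by rewrite /= CodeSeq.decodeK. Qed.
Lemma hd_P x y : hd (P x y) = x. Proof. by rewrite P_code /hd CodeSeq.codeK. Qed.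
Lemma tl_P x y : tl (P x y) = y.
Proof. by rewrite P_code /tl CodeSeq.codeK CodeSeq.decodeK. Qed.
Lemma P_neq0 x y : (P x y == 0) = false.
Proof. by rewrite /P muln_eq0 expn_eq0. Qed.
Lemma P_surj n : n != 0 -> n = P (hd n) (tl n).
Proof.
rewrite -{1 2}(CodeSeq.decodeK n) /hd /tl.
by case: (CodeSeq.decode n).
Qed.
Lemma hd_lt n : n != 0 -> hd n < n.
Proof.
move/P_surj => {2}->; rewrite /P; set x := hd n; set y := tl n.
by rewrite (leq_trans (ltn_expl x (ltnSn 1))) // leq_pmulr.
Qed.
Lemma tl_lt n : n != 0 -> tl n < n.
Proof.
move/P_surj => {2}->; rewrite /P; set x := hd n; set y := tl n.
have : 0 < 2 ^ x by rewrite expn_gt0.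
by move: (2 ^ x) => k; nia.
Qed.
Lemma PW x y : P x y != 0. Proof. by rewrite P_neq0. Qed.

Lemma rec2_P : rec2 P.
Proof.
apply: (recursive_comp2 rec2_mul).
  by apply: (recursive_comp1 rec1_pow2); rproj.
apply: (recursive_comp1 rec1_succ).
have : rec1 (fun n => n.*2).
  apply: rec1_ext (recursive_comp2 rec2_add rec1_id rec1_id) => n.
  by rewrite -addnn.
by move=> h; apply: (recursive_comp1 h); rproj.
Qed.

Lemma rec1_hd : rec1 hd.
Proof.
(* For nonzero [n], [hd n] is its 2-adic valuation, the least number of halvings that gives an odd
   number. The factor [n != 0] ends the search at once for [n = 0], where [hd] is 0. *)
pose g h n := (n != 0) * ~~ odd (iter h half n).
have hg : rec2 g.
  have nE m : (m == 0) = ~~ (m != 0) by rewrite negbK.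
  have rnot (k : nat) (f : k.-tuple nat -> bool) :
      recursive (fun v => f v : nat) -> recursive (fun v => ~~ f v : nat).
    move=> hf; apply: rec_ext (recursive_comp1 rec1_not hf) => v.
    by case: (f v).
  apply: (recursive_comp2 rec2_mul); apply: rnot.
    by apply: (recursive_comp1 rec1_not); rproj.
  apply: (recursive_comp1 rec1_odd).
  by apply: (recursive_comp2 (rec2_iter rec1_half)); rproj.
apply: (rec_mu hg) => v; set n := tnth v ord0.
have e h : tnth [tuple of h :: v] ord0 = h by rewrite (tnth_nth 0).
have e1 h : tnth [tuple of h :: v] (inord 1) = n.
  by rewrite /n !(tnth_nth 0) /= inordK.
have iterE x m k : k <= x -> iter k half (2 ^ x * m) = 2 ^ (x - k) * m.
  elim: k => [|k IHk] kx /=; first by rewrite subn0.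
  rewrite IHk 1?ltnW // -[x - k]prednK ?subn_gt0 // expnS -mulnA mul2n doubleK.
  by rewrite subnS.
rewrite !e !e1 /g; have [->|n0] := eqVneq n 0; first by rewrite /hd.
split.
  by rewrite {2}(P_surj n0) /P iterE // subnn !mul1n /= odd_double.
move=> h; rewrite !e !e1 n0 => hlt; rewrite {1}(P_surj n0) /P iterE 1?ltnW //.
by rewrite -[_ - h]prednK ?subn_gt0 // expnS -mulnA mul2n odd_double.
Qed.

(** Dividing out the power of two leaves [2 * y + 1]; one more halving gives [y]. *)
Lemma rec1_tl : rec1 tl.
Proof.
have h : rec1 (fun n => half (iter (hd n) half n)).
  apply: (recursive_comp1 rec1_half).
  by apply: (recursive_comp2 (rec2_iter rec1_half) rec1_hd); rproj.
apply: rec1_ext h => n; have [->|n0] := eqVneq n 0; first by [].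
rewrite {2}(P_surj n0) /P; move: (hd n) (tl n) => x y.
suff -> : iter x half (2 ^ x * y.*2.+1) = y.*2.+1 by rewrite /= uphalf_double.
by elim: x => [|x IHx]; rewrite ?mul1n // iterSr expnS -mulnA mul2n doubleK.
Qed.

Lemma rec1_comp f g : rec1 f -> rec1 g -> rec1 (fun n => f (g n)).
Proof. exact: recursive_comp1. Qed.
Lemma rec1_comp2 f g h : rec2 f -> rec1 g -> rec1 h -> rec1 (fun n => f (g n) (h n)).
Proof. exact: recursive_comp2. Qed.
Lemma rec1_P f g : rec1 f -> rec1 g -> rec1 (fun n => P (f n) (g n)).
Proof. exact: recursive_comp2 rec2_P. Qed.

Lemma rec1_cond b f g : rec1 b -> rec1 f -> rec1 g ->
  rec1 (fun n => if b n == 0 then f n else g n).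
Proof.
move=> hb hf hg.
have h1 := rec1_comp2 rec2_mul (rec1_comp rec1_not hb) hf.
have h2 := rec1_comp2 rec2_mul (rec1_comp rec1_not (rec1_comp rec1_not hb)) hg.
apply: rec1_ext (rec1_comp2 rec2_add h1 h2) => n /=.
by case: (b n == 0); rewrite /= ?mul1n ?mul0n ?addn0.
Qed.

Definition prim (z s : nat -> nat) (a n : nat) : nat :=
  nat_rec (fun=> nat) (z a) (fun n r => s (P a (P n r))) n.

Lemma rec1_prim_param z s : rec1 z -> rec1 s ->
  rec1 (fun n => prim z s (hd n) (tl n)).
Proof.
move=> hz hs.
have h3 : rec3 (fun n r a => s (P a (P n r))).
  apply: (recursive_comp1 hs); apply: (recursive_comp2 rec2_P); first rproj.
  by apply: (recursive_comp2 rec2_P); rproj.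
exact: (recursive_comp2 (rec2_prim hz h3) rec1_tl rec1_hd).
Qed.

(** * Course-of-values recursion along the pairing [P] *)

Section TreeRecursion.
Variables (z s : nat -> nat).

Definition get H i := hd (iter i tl H).
Definition tree_step a n H :=
  if n == 0 then z a else
  s (P a (P (P (hd n) (tl n)) (P (get H (n.-1 - hd n)) (get H (n.-1 - tl n))))).
(** Codes the list of the values at [n - 1], ..., 0 in this order; this is why the value at [i] has
    index [n.-1 - i]. *)
Definition history a n :=
  prim (fun=> 0) (fun m => P (tree_step (hd m) (hd (tl m)) (tl (tl m))) (tl (tl m))) a n.
Definition tree_rec a n := tree_step a n (history a n).

Lemma get_history a n i : i < n -> get (history a n) (n.-1 - i) = tree_rec a i.
Proof.
rewrite /get; elim: n => //= n IHn; rewrite ltnS leq_eqVlt => /orP[/eqP->|lt_in].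
  by rewrite subnn /= !hd_P !tl_P !hd_P.
have -> : n - i = (n.-1 - i).+1 by case: n lt_in {IHn} => // n ?; rewrite subSn.
by rewrite iterSr !tl_P -(IHn lt_in).
Qed.

(** Both components of [P x y] are smaller than it, so their values are already in the history. *)
Lemma tree_recP a x y :
  tree_rec a (P x y) = s (P a (P (P x y) (P (tree_rec a x) (tree_rec a y)))).
Proof.
have xlt : x < P x y by have := hd_lt (PW x y); rewrite hd_P.
have ylt : y < P x y by have := tl_lt (PW x y); rewrite tl_P.
by rewrite /tree_rec {1}/tree_step P_neq0 hd_P tl_P !get_history.
Qed.

Lemma rec1_tree : rec1 z -> rec1 s -> rec1 (fun n => tree_rec (hd n) (tl n)).
Proof.
move=> hz hs.
have hget f g : rec1 f -> rec1 g -> rec1 (fun n => get (f n) (g n)).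
  move=> hf hg; apply: (rec1_comp rec1_hd).
  exact: (rec1_comp2 (rec2_iter rec1_tl) hg hf).
have hstep fa fn fH : rec1 fa -> rec1 fn -> rec1 fH ->
    rec1 (fun n => tree_step (fa n) (fn n) (fH n)).
  move=> ha hn hH; have hhd := rec1_comp rec1_hd hn; have htl := rec1_comp rec1_tl hn.
  have hp := rec1_comp rec1_pred hn.
  apply: rec1_cond => //; first exact: rec1_comp hz ha.
  apply: (rec1_comp hs); apply: rec1_P => //; apply: rec1_P; first exact: rec1_P.
  by apply: rec1_P; apply: hget => //; apply: (rec1_comp2 rec2_sub).
have tt := rec1_comp rec1_tl rec1_tl.
apply: (hstep); [exact: rec1_hd | exact: rec1_tl|].
apply: rec1_prim_param; first exact: recursive_const.
apply: rec1_P => //; apply: hstep => //; first exact: rec1_hd.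
exact: rec1_comp rec1_hd rec1_tl.
Qed.

End TreeRecursion.

(** * Computable functions between encoded types *)

Class Enc (A : Type) := enc : A -> nat.
#[global] Instance enc_nat : Enc nat := id.
#[global] Instance enc_bool : Enc bool := nat_of_bool.
#[global] Instance enc_unit : Enc unit := fun _ => 0.
#[global] Instance enc_pair A B (_ : Enc A) (_ : Enc B) : Enc (A * B) :=
  fun p => P (enc p.1) (enc p.2).
#[global] Instance enc_seq A (_ : Enc A) : Enc (seq A) :=
  fun s => CodeSeq.code (map enc s).

Notation rt := (GenTree.tree nat).
Notation RV := (@GenTree.Leaf nat).
Notation RF := (@GenTree.Node nat).

(** Agrees clause by clause with [code_term], so that embedding a term of any signature preserves
    its code. *)
Fixpoint code_rt (t : rt) : nat :=
  match t with
  | GenTree.Leaf x => P 0 (P x 0)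
  | GenTree.Node f ts => P 1 (P f (CodeSeq.code (map code_rt ts)))
  end.
#[global] Instance enc_rt : Enc rt := code_rt.

Lemma enc_cons A (eA : Enc A) (x : A) (s : seq A) : enc (x :: s) = P (enc x) (enc s).
Proof. by []. Qed.
Lemma enc_cons_pair A B (eA : Enc A) (eB : Enc B) (x : A) (y : B) :
  enc (x, y) = P (enc x) (enc y).
Proof. by []. Qed.
Lemma enc_Var x : enc (RV x) = P 0 (P x 0). Proof. by []. Qed.
Lemma enc_Fun f ts : enc (RF f ts) = P 1 (P f (enc ts)). Proof. by []. Qed.

Lemma rt_ind (K : rt -> Prop) :
  (forall x, K (RV x)) ->
  (forall f ts, (forall u, u \in ts -> K u) -> K (RF f ts)) -> forall t, K t.
Proof.
move=> KV KF; apply: (@GenTree.tree_ind nat K) => // f ts Kts; apply: KF.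
elim: ts Kts => //= u ts IHts [Ku /IHts Kts] w.
by rewrite inE => /orP[/eqP->|/Kts].
Qed.

Definition computable A B {eA : Enc A} {eB : Enc B} (f : A -> B) : Prop :=
  exists2 g, rec1 g & forall a, enc (f a) = g (enc a).

Section Basic.
Context {A B C D : Type} {eA : Enc A} {eB : Enc B} {eC : Enc C} {eD : Enc D}.

Lemma c_ext (f g : A -> B) : f =1 g -> computable f -> computable g.
Proof. by move=> fg [h hr hE]; exists h => // a; rewrite -fg. Qed.

Lemma c_id : computable (fun a : A => a).
Proof. by exists id => //; exact: rec1_id. Qed.

Lemma c_const (b : B) : computable (fun _ : A => b).
Proof. by exists (fun=> enc b) => //; exact: recursive_const. Qed.

Lemma c_app (g : B -> C) (f : A -> B) :
  computable g -> computable f -> computable (fun a => g (f a)).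
Proof.
move=> [h hr hE] [k kr kE]; exists (fun n => h (k n)); first exact: rec1_comp.
by move=> a; rewrite hE kE.
Qed.

Lemma c_enc (f : A -> B) : computable f -> computable (fun a => enc (f a)).
Proof. by case=> h hr hE; exists h. Qed.

Lemma c_pair (f : A -> B) (g : A -> C) :
  computable f -> computable g -> computable (fun a => (f a, g a)).
Proof.
move=> [h hr hE] [k kr kE]; exists (fun n => P (h n) (k n)); first exact: rec1_P.
by move=> a; rewrite /enc /enc_pair /= hE kE.
Qed.

Lemma c_fst (f : A -> B * C) : computable f -> computable (fun a => (f a).1).
Proof.
move=> [h hr hE]; exists (fun n => hd (h n)); first exact: rec1_comp rec1_hd hr.
by move=> a; rewrite -hE /enc /enc_pair hd_P.
Qed.

Lemma c_snd (f : A -> B * C) : computable f -> computable (fun a => (f a).2).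
Proof.
move=> [h hr hE]; exists (fun n => tl (h n)); first exact: rec1_comp rec1_tl hr.
by move=> a; rewrite -hE /enc /enc_pair tl_P.
Qed.

Lemma c_cons (f : A -> B) (g : A -> seq B) :
  computable f -> computable g -> computable (fun a => f a :: g a).
Proof.
move=> [h hr hE] [k kr kE]; exists (fun n => P (h n) (k n)); first exact: rec1_P.
by move=> a; rewrite -hE -kE.
Qed.

Lemma c_if (b : A -> bool) (f g : A -> B) :
  computable b -> computable f -> computable g ->
  computable (fun a => if b a then f a else g a).
Proof.
move=> [h hr hE] [k kr kE] [l lr lE].
exists (fun n => if h n == 0 then l n else k n); first exact: rec1_cond.
by move=> a; rewrite -hE; case: (b a).
Qed.

Lemma c_Var (f : A -> nat) : computable f -> computable (fun a => RV (f a)).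
Proof.
move=> [h hr hE]; exists (fun n => P 0 (P (h n) 0)).
  by apply: rec1_P; [exact: recursive_const | apply: rec1_P => //; exact: recursive_const].
by move=> a; rewrite -hE.
Qed.

Lemma c_Fun (f : A -> nat) (ts : A -> seq rt) :
  computable f -> computable ts -> computable (fun a => RF (f a) (ts a)).
Proof.
move=> [h hr hE] [k kr kE]; exists (fun n => P 1 (P (h n) (k n))).
  by apply: rec1_P; [exact: recursive_const | apply: rec1_P].
by move=> a; rewrite -hE -kE.
Qed.

End Basic.

Section App.
Context {A B C D E F : Type} {eA : Enc A} {eB : Enc B} {eC : Enc C} {eD : Enc D}
  {eE : Enc E} {eF : Enc F}.

Lemma c_app3 (g : B -> C -> D -> E) (f1 : A -> B) (f2 : A -> C) (f3 : A -> D) :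
  computable (fun p : B * C * D => g p.1.1 p.1.2 p.2) ->
  computable f1 -> computable f2 -> computable f3 ->
  computable (fun a => g (f1 a) (f2 a) (f3 a)).
Proof. by move=> hg h1 h2 h3; exact: (c_app hg (c_pair (c_pair h1 h2) h3)). Qed.

End App.

Create HintDb computability.

(** Follows the shape of the function body: [@?f a] abstracts the argument from each part, and the
    hint database contributes one lemma per further combinator. Functional arguments are treated
    through the hypothesis on their uncurried form. *)
Ltac ct := cbv beta; lazymatch goal with
  | |- computable (fun a => a) => exact: c_id
  | |- computable (fun _ => ?c) => exact: c_const
  | |- computable fst => exact: (c_fst c_id)
  | |- computable snd => exact: (c_snd c_id)
  | |- computable (fun a => (@?f a).1) => apply: (@c_fst _ _ _ _ _ _ f); ct
  | |- computable (fun a => (@?f a).2) => apply: (@c_snd _ _ _ _ _ _ f); ct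
  | |- computable (fun a => (@?f a, @?g a)) => apply: (@c_pair _ _ _ _ _ _ f g); ct
  | |- computable (fun a => @?f a :: @?g a) => apply: (@c_cons _ _ _ _ f g); ct
  | |- computable (fun a => if _ then _ else _) => apply: c_if; ct
  | |- computable (fun a => RV (@?f a)) => apply: (@c_Var _ _ f); ct
  | |- computable (fun a => RF (@?f a) (@?g a)) => apply: (@c_Fun _ _ f g); ct
  | |- _ => first [assumption | solve [auto 1 with computability nocore]
      | match goal with h : computable _ |- _ => apply: (c_app h); ct end | idtac]
  end.

Section Lists.
Context {A B C : Type} {eA : Enc A} {eB : Enc B} {eC : Enc C}.

Fixpoint para (z : C) (k : B -> seq B -> C -> C) (s : seq B) : C :=
  if s is x :: s' then k x s' (para z k s') else z.

(** A list lies along the right spine of its code, so tree recursion serves once the value at each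
    left component is ignored. *)
Lemma c_para (l : A -> seq B) (z : A -> C) (k : A -> B -> seq B -> C -> C) :
  computable l -> computable z ->
  computable (fun p : A * B * seq B * C => k p.1.1.1 p.1.1.2 p.1.2 p.2) ->
  computable (fun a => para (z a) (k a) (l a)).
Proof.
move=> [hl lr lE] [hz zr zE] [hk kr kE].
pose s n := hk (P (P (P (hd n) (hd (hd (tl n)))) (tl (hd (tl n)))) (tl (tl (tl n)))).
have sr : rec1 s.
  have r12 := rec1_comp rec1_hd rec1_tl; have r22 := rec1_comp rec1_tl rec1_tl.
  apply: (rec1_comp kr); apply: rec1_P; last exact: rec1_comp rec1_tl r22.
  apply: rec1_P; last exact: rec1_comp rec1_tl r12.
  by apply: rec1_P; [exact: rec1_hd | exact: rec1_comp rec1_hd r12].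
exists (fun n => tree_rec hz s n (hl n)).
  apply: rec1_ext (rec1_comp (rec1_tree zr sr) (rec1_P rec1_id lr)) => n.
  by rewrite hd_P tl_P.
move=> a; rewrite -lE; elim: (l a) => [|x s' IHs] /=; first by rewrite zE.
rewrite enc_cons tree_recP -IHs.
by rewrite (kE (a, x, s', _)) /s !(hd_P, tl_P).
Qed.

Lemma c_foldr (l : A -> seq B) (z : A -> C) (k : A -> B -> C -> C) :
  computable l -> computable z ->
  computable (fun p : A * B * C => k p.1.1 p.1.2 p.2) ->
  computable (fun a => foldr (k a) (z a) (l a)).
Proof.
move=> hl hz hk.
apply: (@c_ext _ _ _ _ (fun a => para (z a) (fun x _ r => k a x r) (l a))).
  by move=> a; elim: (l a) => //= x s ->.
apply: (@c_para l z (fun a x _ r => k a x r)) => //.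
by apply: (c_app3 hk); ct.
Qed.

End Lists.

Lemma c_eqn A {eA : Enc A} (f g : A -> nat) :
  computable f -> computable g -> computable (fun a => f a == g a).
Proof.
move=> [h hr hE] [k kr kE].
(* Equality means that both truncated differences vanish. *)
exists (fun n => (h n - k n) + (k n - h n) == 0).
  apply: (rec1_comp rec1_not); apply: (rec1_comp2 rec2_add);
  exact: (rec1_comp2 rec2_sub).
move=> a; rewrite -hE -kE /enc /enc_nat /enc_bool; congr nat_of_bool.
by rewrite addn_eq0 !subn_eq0 eqn_leq.
Qed.

Lemma c_iter A B {eA : Enc A} {eB : Enc B} (n : A -> nat) (f : A -> B -> B) (x : A -> B) :
  computable n -> computable x -> computable (fun p : A * B => f p.1 p.2) ->
  computable (fun a => iter (n a) (f a) (x a)).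
Proof.
move=> [hn nr nE] [hx xr xE] [hf fr fE].
pose s m := hf (P (hd m) (tl (tl m))).
have sr : rec1 s.
  apply: (rec1_comp fr); apply: rec1_P; first exact: rec1_hd.
  exact: rec1_comp rec1_tl rec1_tl.
exists (fun m => prim hx s m (hn m)).
  apply: rec1_ext (rec1_comp (rec1_prim_param xr sr) (rec1_P rec1_id nr)) => m.
  by rewrite hd_P tl_P.
move=> a; rewrite -nE /enc /enc_nat; elim: (n a) => //= m IHm.
by rewrite [LHS](fE (a, _)) {1}/s hd_P !tl_P -IHm.
Qed.

Section TermFold.
Context {A B : Type} {eA : Enc A} {eB : Enc B}.

(** The node case receives the subtrees beside their values, because [rargs] and [decs] return
    subtrees. *)
Fixpoint tfold (v : nat -> B) (g : nat -> seq (rt * B) -> B) (t : rt) : B :=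
  match t with
  | GenTree.Leaf x => v x
  | GenTree.Node f ts => g f [seq (u, tfold v g u) | u <- ts]
  end.

Lemma c_tfold (v : A -> nat -> B) (g : A -> nat -> seq (rt * B) -> B) (t : A -> rt) :
  computable (fun p : A * nat => v p.1 p.2) ->
  computable (fun p : A * nat * seq (rt * B) => g p.1.1 p.1.2 p.2) ->
  computable t -> computable (fun a => tfold (v a) (g a) (t a)).
Proof.
move=> [hv vr vE] [hg gr gE] [ht tr tE].
(* The tree recursion computes, for every subtree, its value as a term paired
   with its value as a list of terms. *)
pose s n := let a := hd n in let x := hd (hd (tl n)) in let y := tl (hd (tl n)) in
  let rx := hd (tl (tl n)) in let ry := tl (tl (tl n)) in
  P (if x == 0 then hv (P a (hd y)) else hg (P (P a (hd y)) (tl (tl ry))))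
    (P (P x (hd rx)) (tl ry)).
have sr : rec1 s.
  have r12 := rec1_comp rec1_hd rec1_tl; have r22 := rec1_comp rec1_tl rec1_tl.
  have x_ := rec1_comp rec1_hd r12; have y_ := rec1_comp rec1_tl r12.
  have rx_ := rec1_comp rec1_hd r22; have ry_ := rec1_comp rec1_tl r22.
  have hy := rec1_comp rec1_hd y_; have try_ := rec1_comp rec1_tl ry_.
  have ahy := rec1_P rec1_hd hy.
  apply: rec1_P; last by do 2?apply: rec1_P => //; exact: rec1_comp rec1_hd rx_.
  apply: rec1_cond => //; first exact: rec1_comp vr ahy.
  by apply: (rec1_comp gr); apply: rec1_P => //; exact: rec1_comp rec1_tl try_.
(* The second component 0 of the leaf value codes the empty list, which is the value of the empty
   list of terms. *)
pose T := tree_rec (fun=> P 0 0) s.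
have Tr : rec1 (fun n => T (hd n) (tl n)) by apply: rec1_tree => //; exact: recursive_const.
exists (fun n => hd (T n (ht n))).
  apply: (rec1_comp rec1_hd).
  by apply: rec1_ext (rec1_comp Tr (rec1_P rec1_id tr)) => n; rewrite hd_P tl_P.
move=> a; rewrite -tE.
have TP x y : T (enc a) (P x y) =
    s (P (enc a) (P (P x y) (P (T (enc a) x) (T (enc a) y)))) by exact: tree_recP.
have H : forall u, hd (T (enc a) (enc u)) = enc (tfold (v a) (g a) u); last by rewrite H.
elim/rt_ind=> [x|f ts IHts].
  by rewrite enc_Var TP /s !(hd_P, tl_P) /= (vE (a, x)).
pose F u := (u, tfold (v a) (g a) u).
have Hts : tl (T (enc a) (enc ts)) = enc [seq F u | u <- ts].
  elim: ts IHts => [|u ts IH] Hu /=; first by rewrite /T tl_P.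
  have {}IH := IH (fun w hw => Hu w (mem_behead (s := u :: ts) hw)).
  by rewrite enc_cons TP /s !(hd_P, tl_P) IH Hu ?mem_head.
rewrite enc_Fun TP /s !(hd_P, tl_P) /=.
by rewrite TP /s !(hd_P, tl_P) Hts (gE (a, f, _)).
Qed.

End TermFold.

(* Computability of list operations, Boolean connectives and equality tests *)
#[local] Hint Extern 0 (computable (fun _ => foldr _ _ _)) =>
  apply: c_foldr; ct : computability.
#[local] Hint Extern 0 (computable (fun _ => para _ _ _)) =>
  apply: c_para; ct : computability.
#[local] Hint Extern 0 (computable (fun _ => iter _ _ _)) =>
  apply: c_iter; ct : computability.
#[local] Hint Extern 0 (computable (fun _ => tfold _ _ _)) =>
  apply: c_tfold; ct : computability.

Lemma c_cat A B {eA : Enc A} {eB : Enc B} (f g : A -> seq B) :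
  computable f -> computable g -> computable (fun a => f a ++ g a).
Proof.
move=> hf hg; apply: (@c_ext _ _ _ _ (fun a => foldr cons (g a) (f a))).
  by move=> a; elim: (f a) => //= x s ->.
ct.
Qed.
#[local] Hint Extern 0 (computable (fun _ => _ ++ _)) =>
  apply: c_cat; ct : computability.

Lemma c_map A B C {eA : Enc A} {eB : Enc B} {eC : Enc C} (f : A -> B -> C) (l : A -> seq B) :
  computable (fun p : A * B => f p.1 p.2) -> computable l ->
  computable (fun a => map (f a) (l a)).
Proof.
move=> hf hl.
apply: (@c_ext _ _ _ _ (fun a => foldr (fun x r => f a x :: r) [::] (l a))).
  by move=> a; elim: (l a) => //= x s ->.
ct.
Qed.
#[local] Hint Extern 0 (computable (fun _ => map _ _)) =>
  apply: c_map; ct : computability.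

Lemma c_flatten A B {eA : Enc A} {eB : Enc B} (l : A -> seq (seq B)) :
  computable l -> computable (fun a => flatten (l a)).
Proof.
by move=> hl; rewrite /flatten; ct.
Qed.
#[local] Hint Extern 0 (computable (fun _ => flatten _)) =>
  apply: c_flatten; ct : computability.

Lemma c_filter A B {eA : Enc A} {eB : Enc B} (f : A -> B -> bool) (l : A -> seq B) :
  computable (fun p : A * B => f p.1 p.2) -> computable l ->
  computable (fun a => filter (f a) (l a)).
Proof.
move=> hf hl.
apply: (@c_ext _ _ _ _ (fun a => foldr (fun x r => if f a x then x :: r else r) [::] (l a))).
  by move=> a; elim: (l a) => //= x s ->.
ct.
Qed.
#[local] Hint Extern 0 (computable (fun _ => filter _ _)) =>
  apply: c_filter; ct : computability.

Lemma c_has A B {eA : Enc A} {eB : Enc B} (f : A -> B -> bool) (l : A -> seq B) :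
  computable (fun p : A * B => f p.1 p.2) -> computable l ->
  computable (fun a => has (f a) (l a)).
Proof.
move=> hf hl.
apply: (@c_ext _ _ _ _ (fun a => foldr (fun x r => if f a x then true else r) false (l a))).
  by move=> a; elim: (l a) => //= x s ->; case: (f a x).
ct.
Qed.
#[local] Hint Extern 0 (computable (fun _ => has _ _)) =>
  apply: c_has; ct : computability.

Lemma c_all A B {eA : Enc A} {eB : Enc B} (f : A -> B -> bool) (l : A -> seq B) :
  computable (fun p : A * B => f p.1 p.2) -> computable l ->
  computable (fun a => all (f a) (l a)).
Proof.
move=> hf hl.
apply: (@c_ext _ _ _ _ (fun a => foldr (fun x r => if f a x then r else false) true (l a))).
  by move=> a; elim: (l a) => //= x s ->; case: (f a x).
ct.
Qed.
#[local] Hint Extern 0 (computable (fun _ => all _ _)) =>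
  apply: c_all; ct : computability.

Lemma c_S A {eA : Enc A} (f : A -> nat) : computable f -> computable (fun a => (f a).+1).
Proof.
move=> [h hr hE]; exists (fun n => (h n).+1) => [|a]; last by rewrite -hE.
exact: rec1_comp rec1_succ hr.
Qed.
#[local] Hint Extern 0 (computable (fun _ => _.+1)) =>
  apply: c_S; ct : computability.

Lemma c_addn A {eA : Enc A} (f g : A -> nat) :
  computable f -> computable g -> computable (fun a => f a + g a).
Proof.
move=> [h hr hE] [k kr kE]; exists (fun n => h n + k n) => [|a]; last by rewrite -hE -kE.
exact: (rec1_comp2 rec2_add).
Qed.
#[local] Hint Extern 0 (computable (fun _ => _ + _)) =>
  apply: c_addn; ct : computability.

Lemma c_size A B {eA : Enc A} {eB : Enc B} (l : A -> seq B) :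
  computable l -> computable (fun a => size (l a)).
Proof.
move=> hl; apply: (@c_ext _ _ _ _ (fun a => foldr (fun _ n => n.+1) 0 (l a))) => //; ct.
Qed.
#[local] Hint Extern 0 (computable (fun _ => size _)) =>
  apply: c_size; ct : computability.

Lemma c_nth A B {eA : Enc A} {eB : Enc B} (d : B) (l : A -> seq B) (i : A -> nat) :
  computable l -> computable i -> computable (fun a => nth d (l a) (i a)).
Proof.
move=> hl hi.
(* The two instances of [para] are [head d] and [behead]. *)
apply: (@c_ext _ _ _ _ (fun a => para d (fun x _ _ => x)
  (iter (i a) (para [::] (fun _ s _ => s)) (l a)))).
  move=> a; elim: (i a) (l a) => [|n IHn] [|x s] //; rewrite iterSr /= ?IHn //.
  by rewrite nth_nil.
ct.
Qed.
#[local] Hint Extern 0 (computable (fun _ => nth _ _ _)) =>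
  apply: c_nth; ct : computability.

Lemma c_iota A {eA : Enc A} (n : A -> nat) : computable n -> computable (fun a => iota 0 (n a)).
Proof.
move=> hn; apply: (@c_ext _ _ _ _ (fun a => iter (n a) (fun s => s ++ [:: size s]) [::])).
  move=> a; elim: (n a) => // m IHm; rewrite -[in RHS]addn1 iotaD iterS IHm.
  by rewrite size_iota.
ct.
Qed.
#[local] Hint Extern 0 (computable (fun _ => iota 0 _)) =>
  apply: c_iota; ct : computability.

Lemma c_and A {eA : Enc A} (f g : A -> bool) :
  computable f -> computable g -> computable (fun a => f a && g a).
Proof. by move=> hf hg; apply: (c_if hf hg); exact: c_const. Qed.
#[local] Hint Extern 0 (computable (fun _ => _ && _)) =>
  apply: c_and; ct : computability.
Lemma c_or A {eA : Enc A} (f g : A -> bool) :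
  computable f -> computable g -> computable (fun a => f a || g a).
Proof. by move=> hf hg; apply: (c_if hf) => //; exact: c_const. Qed.
#[local] Hint Extern 0 (computable (fun _ => _ || _)) =>
  apply: c_or; ct : computability.

Lemma enc_rt_inj : injective (enc : rt -> nat).
Proof.
elim/rt_ind=> [x|f ts IH] [y|g us].
- by move/(congr1 tl); rewrite !enc_Var !tl_P => /(congr1 hd); rewrite !hd_P => ->.
- by move/(congr1 hd); rewrite enc_Var enc_Fun !hd_P.
- by move/(congr1 hd); rewrite enc_Var enc_Fun !hd_P.
move/(congr1 tl); rewrite !enc_Fun !tl_P => e.
have := congr1 tl e; have := congr1 hd e; rewrite !hd_P !tl_P => -> {}e; congr RF.
elim: ts us e IH => [|t ts IHts] [|u us] //.
- by rewrite enc_cons => /esym/eqP; rewrite P_neq0.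
- by rewrite enc_cons => /eqP; rewrite P_neq0.
rewrite !enc_cons => e IH; have := congr1 tl e; have := congr1 hd e; rewrite !hd_P !tl_P.
move/(IH _ (mem_head _ _)) => -> /IHts -> // w hw; apply: IH.
by rewrite inE hw orbT.
Qed.

Lemma c_eqrt A {eA : Enc A} (f g : A -> rt) :
  computable f -> computable g -> computable (fun a => f a == g a).
Proof.
move=> hf hg; apply: (@c_ext _ _ _ _ (fun a => enc (f a) == enc (g a))).
  by move=> a; rewrite (inj_eq enc_rt_inj).
by apply: c_eqn; apply: c_enc.
Qed.
#[local] Hint Extern 0 (computable (fun _ => @eq_op _ _ _)) =>
  first [apply: c_eqrt | apply: c_eqn]; ct : computability.

(** * The algorithm on raw terms *)

Notation eqs := (seq (rt * rt)).
Notation binds := (seq (nat * rt)).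
(** A context is a list of frames from the root to the hole; a frame holds the symbol and the
    arguments to the left and right of the hole. *)
Notation frame := (nat * (seq rt * seq rt))%type.
(** The final [unit], coded by 0, terminates a list of fixed length, which makes the codes equal to
    those given by [code_equation] and [code_rule]. *)
Notation rcond := (rt * (rt * unit))%type.
Notation rrule := (rt * (rt * (seq rcond * unit)))%type.

Definition rsubst (s : nat -> rt) : rt -> rt :=
  tfold s (fun f rs => RF f (map snd rs)).
Definition rvars : rt -> seq nat :=
  tfold (fun x => [:: x]) (fun _ rs => flatten (map snd rs)).
Definition rsize : rt -> nat :=
  tfold (fun=> 1) (fun _ rs => (foldr addn 0 (map snd rs)).+1).
Definition rvar : rt -> nat := tfold id (fun _ _ => 0).
Definition ris_var : rt -> bool := tfold (fun=> true) (fun _ _ => false).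
Definition rsym : rt -> nat := tfold (fun=> 0) (fun f _ => f).
Definition rargs : rt -> seq rt := tfold (fun=> [::]) (fun _ rs => map fst rs).
Definition rplug (K : seq frame) (u : rt) : rt :=
  foldr (fun fr v => RF fr.1 (fr.2.1 ++ v :: fr.2.2)) u K.
Definition splits B (s : seq B) : seq (seq B * (B * seq B)) :=
  para [::] (fun x s r => ([::], (x, s)) :: map (fun q => (x :: q.1, q.2)) r) s.
(** [splits] selects the argument that contains the hole, and [q.2.1.2] holds the decompositions of
    that argument. *)
Definition decs : rt -> seq (seq frame * rt) :=
  tfold (fun x => [:: ([::], RV x)])
    (fun f rs => ([::], RF f (map fst rs)) ::
       flatten [seq [seq ((f, (map fst q.1, map fst q.2.2)) :: d.1, d.2) | d <- q.2.1.2]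
               | q <- splits rs]).
Definition lookup (b : binds) (x : nat) : rt :=
  foldr (fun p r => if p.1 == x then p.2 else r) (RV x) b.
Definition assigns (xs : seq nat) (U : seq rt) : seq binds :=
  foldr (fun x bs => flatten [seq [seq (x, z) :: b | b <- bs] | z <- U]) [:: [::]] xs.
(** Matching by exhaustion: a matching substitution sends each variable of [l] to a subterm of [u],
    which leaves finitely many candidates. *)
Definition matches (l u : rt) : seq binds :=
  [seq b <- assigns (rvars l) (map snd (decs u)) | rsubst (lookup b) l == u].

Definition hsteps (G : eqs) (s : rt) : seq (eqs * rt) :=
  flatten [seq flatten [seq
     (if d.2 == q.2.1.1 then [:: (q.1 ++ q.2.2, rplug d.1 q.2.1.2)] else [::]) ++
     (if d.2 == q.2.1.2 then [:: (q.1 ++ q.2.2, rplug d.1 q.2.1.1)] else [::])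
   | d <- decs s] | q <- splits G].
(* The pairs [(G', t)] such that [s] can be rewritten to [t] by hypotheses of [G],
   each used at most once and in either direction, [G'] being what remains. *)
Definition reach (G : eqs) (s : rt) : seq (eqs * rt) :=
  iter (size G) (fun sts => sts ++ flatten [seq hsteps st.1 st.2 | st <- sts]) [:: (G, s)].
(** The y_i may repeat, so a variable that already has a value must be given the same one again. *)
Definition thread1 (c : rcond) (st : eqs * binds) : seq (eqs * binds) :=
  [seq (g.1, (rvar c.2.1, g.2) :: st.2) |
     g <- [seq g <- reach st.1 (rsubst (lookup st.2) c.1) |
            if has (fun p => p.1 == rvar c.2.1) st.2
            then lookup st.2 (rvar c.2.1) == g.2 else true]].
(** All conditions draw on one multiset: each searches with the hypotheses that the conditions after
    it have left. *)
Definition thread (cs : seq rcond) (G : eqs) (b : binds) : seq (eqs * binds) :=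
  foldr (fun c sts => flatten [seq thread1 c st | st <- sts]) [:: (G, b)] cs.
Definition step1s (R : seq rrule) (G : eqs) (s : rt) : seq (eqs * rt) :=
  flatten [seq flatten [seq flatten [seq
     [seq (st.1, rplug d.1 (rsubst (lookup st.2) rho.2.1)) | st <- thread rho.2.2.1 G b]
   | b <- matches rho.1 d.2] | d <- decs s] | rho <- R].
Definition conv0b (G : eqs) (s t : rt) : bool := has (fun g => g.2 == t) (reach G s).
Definition fwd1b (R : seq rrule) (G : eqs) (s t : rt) : bool :=
  has (fun g1 => has (fun g2 => conv0b g2.1 g2.2 t) (step1s R g1.1 g1.2)) (reach G s).
Definition conv1b (R : seq rrule) (G : eqs) (s t : rt) : bool :=
  fwd1b R G s t || fwd1b R G t s.
(* Both ends are given. One condition [x ~ y] of the rule takes the inner step;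
   when no other condition determines [y], its value is read off [w]. *)
Definition step2b (R : seq rrule) (G : eqs) (s w : rt) : bool :=
  has (fun rho : rrule => has (fun d => has (fun b =>
    has (fun q : seq rcond * (rcond * seq rcond) => has (fun st : eqs * binds =>
      has (fun z => conv1b R st.1 (rsubst (lookup st.2) q.2.1.1) z
                 && (rplug d.1 (rsubst (lookup (st.2 ++ [:: (rvar q.2.1.2.1, z)])) rho.2.1) == w))
        (if has (fun p => p.1 == rvar q.2.1.2.1) st.2 then [:: lookup st.2 (rvar q.2.1.2.1)]
         else map snd (decs w)))
      (thread (q.1 ++ q.2.2) G b)) (splits rho.2.2.1))
    (matches rho.1 d.2)) (decs s)) R.
Definition step_convb (R : seq rrule) (G : eqs) (s t : rt) : bool :=
  has (fun g => conv0b g.1 g.2 t || conv1b R g.1 g.2 t) (step1s R G s)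
  || has (fun g => step2b R g.1 s g.2) (reach G t).
Definition joinableb (R : seq rrule) (G : eqs) (s t : rt) : bool :=
  [|| conv0b G s t, conv1b R G s t, step2b R G s t, step2b R G t s
    | step_convb R G s t && step_convb R G t s].

Definition ustep (todo : eqs) (b : binds) : seq (eqs * binds) :=
  para [:: ([::], b)] (fun p rest _ =>
    if ris_var p.1 then [:: (rest, (rvar p.1, p.2) :: b)]
    else if ris_var p.2 then [:: (rest, (rvar p.2, p.1) :: b)]
    else if (rsym p.1 == rsym p.2) && (size (rargs p.1) == size (rargs p.2)) then
      [:: ([seq (nth (RV 0) (rargs p.1) i, nth (RV 0) (rargs p.2) i)
            | i <- iota 0 (size (rargs p.1))] ++ rest, b)]
    else [::]) todo.
(* Complete only for linear terms without common variables: no occurs check and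
   no propagation of bindings is needed for them. Failure is the empty list. *)
Definition unify (s t : rt) : seq (eqs * binds) :=
  iter (rsize s) (fun sts => flatten [seq ustep st.1 st.2 | st <- sts]) [:: ([:: (s, t)], [::])].

(** Renaming apart: even variables for the inner rule of an overlap, odd ones for the outer rule. *)
Definition rrename (odd : bool) (t : rt) : rt := rsubst (fun x => RV (odd + (x + x))) t.
Definition overlap_ok (R : seq rrule) (rho1 rho2 : rrule) (K : seq frame) (b : binds) : bool :=
  joinableb R
    ([seq (rsubst (lookup b) (rrename false c.1), rsubst (lookup b) (rrename false c.2.1))
     | c <- rho1.2.2.1] ++
     [seq (rsubst (lookup b) (rrename true c.1), rsubst (lookup b) (rrename true c.2.1))
     | c <- rho2.2.2.1])
    (rsubst (lookup b) (rplug K (rrename false rho1.2.1)))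
    (rsubst (lookup b) (rrename true rho2.2.1)).
(** Failure of unification gives the empty list, on which the inner test succeeds vacuously.
    Identity of the rules is tested on their codes, which are injective. *)
Definition critical_pairs_ok (R : seq rrule) (rho1 rho2 : rrule) : bool :=
  all (fun d : seq frame * rt =>
    ris_var d.2 || ((size d.1 == 0) && (enc rho1 == enc rho2)) ||
    all (fun st : eqs * binds => overlap_ok R rho1 rho2 d.1 st.2)
      (unify (rrename false rho1.1) d.2))
    (decs (rrename true rho2.1)).
Definition decideb (R : seq rrule) : bool :=
  all (fun rho1 => all (critical_pairs_ok R rho1) R) R.

(* Computability of the algorithm *)
#[local] Hint Extern 0 (computable (fun _ => enc _)) => apply: c_enc; ct : computability.
Lemma c_rsubst A {eA : Enc A} (s : A -> nat -> rt) (t : A -> rt) :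
  computable (fun p : A * nat => s p.1 p.2) -> computable t ->
  computable (fun a => rsubst (s a) (t a)).
Proof. by move=> hs ht; rewrite /rsubst; ct. Qed.
#[local] Hint Extern 0 (computable (fun _ => rsubst _ _)) =>
  apply: c_rsubst; ct : computability.
Lemma c_rplug A {eA : Enc A} (K : A -> seq frame) t : computable K -> computable t ->
  computable (fun a => rplug (K a) (t a)).
Proof. by move=> hs ht; rewrite /rplug; ct. Qed.
#[local] Hint Extern 0 (computable (fun _ => rplug _ _)) =>
  apply: c_rplug; ct : computability.
Lemma c_splits A B {eA : Enc A} {eB : Enc B} (s : A -> seq B) : computable s ->
  computable (fun a => splits (s a)).
Proof. by move=> hs; rewrite /splits; ct. Qed.
#[local] Hint Extern 0 (computable (fun _ => splits _)) =>
  apply: c_splits; ct : computability.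

Lemma c_rvars A {eA : Enc A} (t : A -> rt) :
  computable t -> computable (fun a => rvars (t a)).
Proof. by move=> ht; rewrite /rvars; ct. Qed.
#[local] Hint Extern 0 (computable (fun _ => rvars _)) =>
  apply: c_rvars; ct : computability.
Lemma c_rsize A {eA : Enc A} (t : A -> rt) :
  computable t -> computable (fun a => rsize (t a)).
Proof. by move=> ht; rewrite /rsize; ct. Qed.
#[local] Hint Extern 0 (computable (fun _ => rsize _)) =>
  apply: c_rsize; ct : computability.
Lemma c_rvar A {eA : Enc A} (t : A -> rt) :
  computable t -> computable (fun a => rvar (t a)).
Proof. by move=> ht; rewrite /rvar; ct. Qed.
#[local] Hint Extern 0 (computable (fun _ => rvar _)) =>
  apply: c_rvar; ct : computability.
Lemma c_ris_var A {eA : Enc A} (t : A -> rt) :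
  computable t -> computable (fun a => ris_var (t a)).
Proof. by move=> ht; rewrite /ris_var; ct. Qed.
#[local] Hint Extern 0 (computable (fun _ => ris_var _)) =>
  apply: c_ris_var; ct : computability.
Lemma c_rsym A {eA : Enc A} (t : A -> rt) :
  computable t -> computable (fun a => rsym (t a)).
Proof. by move=> ht; rewrite /rsym; ct. Qed.
#[local] Hint Extern 0 (computable (fun _ => rsym _)) =>
  apply: c_rsym; ct : computability.
Lemma c_rargs A {eA : Enc A} (t : A -> rt) :
  computable t -> computable (fun a => rargs (t a)).
Proof. by move=> ht; rewrite /rargs; ct. Qed.
#[local] Hint Extern 0 (computable (fun _ => rargs _)) =>
  apply: c_rargs; ct : computability.
Lemma c_decs A {eA : Enc A} (t : A -> rt) :
  computable t -> computable (fun a => decs (t a)).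
Proof. by move=> ht; rewrite /decs; ct. Qed.
#[local] Hint Extern 0 (computable (fun _ => decs _)) =>
  apply: c_decs; ct : computability.
Lemma c_lookup A {eA : Enc A} (b : A -> binds) (x : A -> nat) :
  computable b -> computable x -> computable (fun a => lookup (b a) (x a)).
Proof. by move=> hb hx; rewrite /lookup; ct. Qed.
#[local] Hint Extern 0 (computable (fun _ => lookup _ _)) =>
  apply: c_lookup; ct : computability.

Lemma c_assigns A {eA : Enc A} (xs : A -> seq nat) (U : A -> seq rt) :
  computable xs -> computable U -> 
  computable (fun a => assigns (xs a) (U a)).
Proof. by move=> hxs hU; rewrite /assigns; ct. Qed.
#[local] Hint Extern 0 (computable (fun _ => assigns _ _)) =>
  apply: c_assigns; ct : computability.

Lemma c_matches A {eA : Enc A} (l : A -> rt) (u : A -> rt) :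
  computable l -> computable u -> 
  computable (fun a => matches (l a) (u a)).
Proof. by move=> hl hu; rewrite /matches; ct. Qed.
#[local] Hint Extern 0 (computable (fun _ => matches _ _)) =>
  apply: c_matches; ct : computability.

Lemma c_hsteps A {eA : Enc A} (G : A -> eqs) (s : A -> rt) :
  computable G -> computable s -> 
  computable (fun a => hsteps (G a) (s a)).
Proof. by move=> hG hs; rewrite /hsteps; ct. Qed.
#[local] Hint Extern 0 (computable (fun _ => hsteps _ _)) =>
  apply: c_hsteps; ct : computability.

Lemma c_reach A {eA : Enc A} (G : A -> eqs) (s : A -> rt) :
  computable G -> computable s -> 
  computable (fun a => reach (G a) (s a)).
Proof. by move=> hG hs; rewrite /reach; ct. Qed.
#[local] Hint Extern 0 (computable (fun _ => reach _ _)) =>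
  apply: c_reach; ct : computability.

Lemma c_thread1 A {eA : Enc A} (c : A -> rcond) (st : A -> eqs * binds) :
  computable c -> computable st -> 
  computable (fun a => thread1 (c a) (st a)).
Proof. by move=> hc hst; rewrite /thread1; ct. Qed.
#[local] Hint Extern 0 (computable (fun _ => thread1 _ _)) =>
  apply: c_thread1; ct : computability.

Lemma c_thread A {eA : Enc A} (cs : A -> seq rcond) (G : A -> eqs) (b : A -> binds) :
  computable cs -> computable G -> computable b -> 
  computable (fun a => thread (cs a) (G a) (b a)).
Proof. by move=> hcs hG hb; rewrite /thread; ct. Qed.
#[local] Hint Extern 0 (computable (fun _ => thread _ _ _)) =>
  apply: c_thread; ct : computability.

Lemma c_step1s A {eA : Enc A} (R : A -> seq rrule) (G : A -> eqs) (s : A -> rt) :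
  computable R -> computable G -> computable s -> 
  computable (fun a => step1s (R a) (G a) (s a)).
Proof. by move=> hR hG hs; rewrite /step1s; ct. Qed.
#[local] Hint Extern 0 (computable (fun _ => step1s _ _ _)) =>
  apply: c_step1s; ct : computability.

Lemma c_conv0b A {eA : Enc A} (G : A -> eqs) (s : A -> rt) (t : A -> rt) :
  computable G -> computable s -> computable t -> 
  computable (fun a => conv0b (G a) (s a) (t a)).
Proof. by move=> hG hs ht; rewrite /conv0b; ct. Qed.
#[local] Hint Extern 0 (computable (fun _ => conv0b _ _ _)) =>
  apply: c_conv0b; ct : computability.

Lemma c_fwd1b A {eA : Enc A} (R : A -> seq rrule) (G : A -> eqs) (s : A -> rt) (t : A -> rt) :
  computable R -> computable G -> computable s -> computable t -> 
  computable (fun a => fwd1b (R a) (G a) (s a) (t a)).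
Proof. by move=> hR hG hs ht; rewrite /fwd1b; ct. Qed.
#[local] Hint Extern 0 (computable (fun _ => fwd1b _ _ _ _)) =>
  apply: c_fwd1b; ct : computability.

Lemma c_conv1b A {eA : Enc A} (R : A -> seq rrule) (G : A -> eqs) (s : A -> rt) (t : A -> rt) :
  computable R -> computable G -> computable s -> computable t -> 
  computable (fun a => conv1b (R a) (G a) (s a) (t a)).
Proof. by move=> hR hG hs ht; rewrite /conv1b; ct. Qed.
#[local] Hint Extern 0 (computable (fun _ => conv1b _ _ _ _)) =>
  apply: c_conv1b; ct : computability.

Lemma c_step2b A {eA : Enc A} (R : A -> seq rrule) (G : A -> eqs) (s : A -> rt) (t : A -> rt) :
  computable R -> computable G -> computable s -> computable t -> 
  computable (fun a => step2b (R a) (G a) (s a) (t a)).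
Proof. by move=> hR hG hs ht; rewrite /step2b; ct. Qed.
#[local] Hint Extern 0 (computable (fun _ => step2b _ _ _ _)) =>
  apply: c_step2b; ct : computability.

Lemma c_step_convb A {eA : Enc A} (R : A -> seq rrule) (G : A -> eqs) (s : A -> rt) (t : A -> rt) :
  computable R -> computable G -> computable s -> computable t -> 
  computable (fun a => step_convb (R a) (G a) (s a) (t a)).
Proof. by move=> hR hG hs ht; rewrite /step_convb; ct. Qed.
#[local] Hint Extern 0 (computable (fun _ => step_convb _ _ _ _)) =>
  apply: c_step_convb; ct : computability.

Lemma c_joinableb A {eA : Enc A} (R : A -> seq rrule) (G : A -> eqs) (s : A -> rt) (t : A -> rt) :
  computable R -> computable G -> computable s -> computable t -> 
  computable (fun a => joinableb (R a) (G a) (s a) (t a)).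
Proof. by move=> hR hG hs ht; rewrite /joinableb; ct. Qed.
#[local] Hint Extern 0 (computable (fun _ => joinableb _ _ _ _)) =>
  apply: c_joinableb; ct : computability.

Lemma c_ustep A {eA : Enc A} (todo : A -> eqs) (b : A -> binds) :
  computable todo -> computable b -> 
  computable (fun a => ustep (todo a) (b a)).
Proof. by move=> htodo hb; rewrite /ustep; ct. Qed.
#[local] Hint Extern 0 (computable (fun _ => ustep _ _)) =>
  apply: c_ustep; ct : computability.

Lemma c_unify A {eA : Enc A} (s : A -> rt) (t : A -> rt) :
  computable s -> computable t -> 
  computable (fun a => unify (s a) (t a)).
Proof. by move=> hs ht; rewrite /unify; ct. Qed.
#[local] Hint Extern 0 (computable (fun _ => unify _ _)) =>
  apply: c_unify; ct : computability.

Lemma c_rrename A {eA : Enc A} (odd : A -> bool) (t : A -> rt) :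
  computable odd -> computable t -> 
  computable (fun a => rrename (odd a) (t a)).
Proof. by move=> hodd ht; rewrite /rrename; ct. Qed.
#[local] Hint Extern 0 (computable (fun _ => rrename _ _)) =>
  apply: c_rrename; ct : computability.

Lemma c_overlap_ok A {eA : Enc A} (R : A -> seq rrule) (r r' : A -> rrule)
    (K : A -> seq frame) (b : A -> binds) :
  computable R -> computable r -> computable r' -> computable K -> computable b ->
  computable (fun a => overlap_ok (R a) (r a) (r' a) (K a) (b a)).
Proof. by move=> hR hr hr' hK hb; rewrite /overlap_ok; ct. Qed.
#[local] Hint Extern 0 (computable (fun _ => overlap_ok _ _ _ _ _)) =>
  apply: c_overlap_ok; ct : computability.

Lemma c_critical_pairs_ok A {eA : Enc A} (R : A -> seq rrule) (r : A -> rrule) (r' : A -> rrule) :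
  computable R -> computable r -> computable r' -> 
  computable (fun a => critical_pairs_ok (R a) (r a) (r' a)).
Proof. by move=> hR hr hr'; rewrite /critical_pairs_ok; ct. Qed.
#[local] Hint Extern 0 (computable (fun _ => critical_pairs_ok _ _ _)) =>
  apply: c_critical_pairs_ok; ct : computability.

Lemma c_decideb A {eA : Enc A} (R : A -> seq rrule) :
  computable R -> 
  computable (fun a => decideb (R a)).
Proof. by move=> hR; rewrite /decideb; ct. Qed.

(** * Raw terms and terms over a signature *)

Lemma rsubst_Var s x : rsubst s (RV x) = s x. Proof. by []. Qed.
Lemma rvar_Var x : rvar (RV x) = x. Proof. by []. Qed.
Lemma rsubst_Fun s f ts : rsubst s (RF f ts) = RF f (map (rsubst s) ts).
Proof. by rewrite /rsubst /= -map_comp. Qed.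

Lemma rvars_Fun f ts : rvars (RF f ts) = flatten (map rvars ts).
Proof. by rewrite /rvars /= -map_comp. Qed.

Lemma splitsP (T : eqType) (s : seq T) q :
  (q \in splits s) = (s == q.1 ++ q.2.1 :: q.2.2).
Proof.
elim: s q => [|x s IHs] [q1 [y q2]] /=; first by case: q1.
rewrite in_cons; apply/orP/eqP => [[/eqP[-> -> ->] //|/mapP[[r1 [w r2]]]]|].
  by rewrite IHs /= => /eqP-> [-> -> ->].
case: q1 => [[-> ->]|z q1 [-> sE]]; first by left.
by right; apply/mapP; exists (q1, (y, q2)); rewrite ?IHs ?sE /=.
Qed.

Lemma splits_map (T T' : Type) (h : T -> T') (s : seq T) :
  splits (map h s) = [seq (map h q.1, (h q.2.1, map h q.2.2)) | q <- splits s].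
Proof.
rewrite /splits; elim: s => //= x s ->; congr (_ :: _).
by rewrite -!map_comp.
Qed.

Lemma decs_Fun f ts : decs (RF f ts) = ([::], RF f ts) ::
  flatten [seq [seq ((f, (q.1, q.2.2)) :: d.1, d.2) | d <- decs q.2.1] | q <- splits ts].
Proof.
rewrite /decs /=; have mfst (us : seq rt) : [seq i.1 | i <- [seq (u, decs u) | u <- us]] = us.
  by rewrite -map_comp map_id.
rewrite -/decs mfst; congr (_ :: flatten _); rewrite splits_map -map_comp.
by apply: eq_map => q /=; rewrite !mfst.
Qed.

Lemma decsP d t : (d \in decs t) = (rplug d.1 d.2 == t).
Proof.
elim/rt_ind: t d => [x|f ts IH] [K u] /=.
  by case: K => [|fr K]; rewrite inE xpair_eqE.
rewrite decs_Fun inE xpair_eqE; apply/idP/idP.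
  case/orP=> [/andP[/eqP-> /eqP->]//|/flattenP[s /mapP[[q1 [v q2]]]]].
  rewrite splitsP /= => /eqP tsE -> /mapP[[K' w] Kw [-> ->]] /=.
  by move: Kw; rewrite IH ?tsE /= => [/eqP->|] //; rewrite mem_cat mem_head orbT.
case: K => [|[g [q1 q2]] K] /eqP /=; first by move=> ->; rewrite eqxx.
case=> -> tsE; apply/flattenP; pose v := rplug K u.
exists [seq ((f, (q1, q2)) :: d.1, d.2) | d <- decs v].
  by apply/mapP; exists (q1, (v, q2)); rewrite // splitsP tsE.
by apply/mapP; exists (K, u); rewrite // IH -?tsE // mem_cat mem_head orbT.
Qed.

Section Raw.
Variables (F : countType) (ar : F -> nat).
Implicit Types (t u w : term ar) (G : seq (equation ar)).

Fixpoint raw t : rt :=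
  match t with
  | Var x => RV x
  | Fun f a => RF (pickle f) [seq raw (a i) | i <- enum 'I_(ar f)]
  end.

Lemma term_ffun_ind (K : term ar -> Prop) :
  (forall x, K (Var x)) ->
  (forall f (a : {ffun 'I_(ar f) -> term ar}), (forall i, K (a i)) -> K (Fun f a)) ->
  forall t, K t.
Proof. by move=> KV KF; fix IH 1 => -[x|f a]; [exact: KV | apply: KF => i; exact: IH]. Qed.

Lemma enc_raw t : enc (raw t) = code_term t.
Proof.
elim/term_ffun_ind: t => //= f a IH; rewrite enc_Fun; congr (P _ (P _ _)).
by rewrite /enc /enc_seq -map_comp; congr CodeSeq.code; apply: eq_map.
Qed.

Lemma raw_inj : injective raw.
Proof. by move=> t u e; apply: (@code_term_inj F ar); rewrite -!enc_raw e. Qed.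

Lemma raw_subst (s : nat -> term ar) t : raw (subst s t) = rsubst (fun x => raw (s x)) (raw t).
Proof.
elim/term_ffun_ind: t => //= f a IH; rewrite rsubst_Fun; congr RF.
by rewrite -map_comp; apply: eq_map => i; rewrite /= ffunE IH.
Qed.

Lemma raw_vars t : rvars (raw t) = vars t.
Proof.
elim/term_ffun_ind: t => //= f a IH; rewrite rvars_Fun -map_comp.
by congr flatten; apply: eq_map => i; rewrite /= IH.
Qed.

Lemma eq_subst (s1 s2 : nat -> term ar) t :
  {in vars t, s1 =1 s2} -> subst s1 t = subst s2 t.
Proof.
elim/term_ffun_ind: t => [x|f a IH] /= eq12; first by apply: eq12; rewrite mem_seq1.
congr Fun; apply/ffunP=> i; rewrite !ffunE; apply: IH => x xi; apply: eq12.
by apply/flattenP; exists (vars (a i)) => //; apply/map_f/mem_enum.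
Qed.

Lemma eq_rsubst (s1 s2 : nat -> rt) v : s1 =1 s2 -> rsubst s1 v = rsubst s2 v.
Proof.
move=> e; elim/rt_ind: v => [x|f ts IH] /=; first exact: e.
by rewrite !rsubst_Fun; congr RF; apply/eq_in_map.
Qed.

Fixpoint raw_ctx (C : ctx ar) : seq frame :=
  match C with
  | Hole => [::]
  | CFun f i a D =>
      (pickle f, ([seq raw (a j) | j <- take i (enum 'I_(ar f))],
                  [seq raw (a j) | j <- drop i.+1 (enum 'I_(ar f))])) :: raw_ctx D
  end.

Lemma enum_split n (i : 'I_n) :
  enum 'I_n = take i (enum 'I_n) ++ i :: drop i.+1 (enum 'I_n).
Proof.
rewrite -{1}(cat_take_drop i (enum 'I_n)); congr (_ ++ _).
by rewrite (drop_nth i) ?size_enum_ord // nth_ord_enum.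
Qed.

Lemma notin_enum_split n (i j : 'I_n) :
  j \in take i (enum 'I_n) ++ drop i.+1 (enum 'I_n) -> j != i.
Proof.
move=> h; apply: contraTneq (enum_uniq 'I_n) => ji; move: h; rewrite ji.
rewrite [X in uniq X](enum_split i) -cat_rcons cat_uniq rcons_uniq mem_cat.
case/orP=> ih; first by rewrite ih.
suff -> : has (mem (rcons (take i (enum 'I_n)) i)) (drop i.+1 (enum 'I_n)) by rewrite andbF.
by apply/hasP; exists i => //=; rewrite mem_rcons mem_head.
Qed.

Lemma raw_plug C t : raw (plug C t) = rplug (raw_ctx C) (raw t).
Proof.
elim: C => //= f i a D IH; congr RF; rewrite -IH.
have E (s : seq 'I_(ar f)) :
    {subset s <= take i (enum 'I_(ar f)) ++ drop i.+1 (enum 'I_(ar f))} ->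
    [seq raw ([ffun j => if j == i then plug D t else a j] j) | j <- s] = [seq raw (a j) | j <- s].
  move=> sub; apply/eq_in_map => j /sub /notin_enum_split; rewrite ffunE.
  by case: eqP.
rewrite [X in map _ X](enum_split i) map_cat /= !E ?ffunE ?eqxx //.
  by move=> j jd; rewrite mem_cat jd orbT.
by move=> j jd; rewrite mem_cat jd.
Qed.

(** Guarantees that the search never leaves the image of the embedding, although its trees know no
    arities. *)
Lemma rplug_raw K v t :
  rplug K v = raw t -> exists C u, [/\ K = raw_ctx C, v = raw u & t = plug C u].
Proof.
elim: K t => [|[g [q1 q2]] K IH] t /=; first by exists (Hole ar), t.
case: t => //= f a [-> e].
(* The number of arguments to the left of the hole is the argument index of the hole. *)
have sz : size q1 < ar f.
  rewrite -(size_enum_ord (ar f)) -(size_map (fun i => raw (a i))) -e size_cat /=.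
  by rewrite addnS ltnS leq_addr.
pose i := Ordinal sz; move: e; rewrite (enum_split i) map_cat /= => /eqP.
rewrite eqseq_cat ?size_map ?size_take ?size_enum_ord ?sz // eqseq_cons.
case/and3P=> /eqP-> /eqP/IH[C [u [-> -> aE]]] /eqP->.
exists (CFun i a C), u; split=> //=; first by rewrite size_map size_takel ?size_enum_ord 1?ltnW.
congr Fun; apply/ffunP=> j.
by rewrite ffunE; case: eqP => [->|].
Qed.

Lemma raw_decsP d t : d \in decs (raw t) ->
  exists C u, [/\ d = (raw_ctx C, raw u) & t = plug C u].
Proof.
case: d => K v; rewrite decsP /= => /eqP/rplug_raw[C [u [-> -> ->]]].
by exists C, u.
Qed.

Lemma mem_raw_decs C t : (raw_ctx C, raw t) \in decs (raw (plug C t)).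
Proof. by rewrite decsP raw_plug. Qed.

Notation tbinds := (seq (nat * term ar)).
Definition raw_eqs G : eqs := [seq (raw e.1, raw e.2) | e <- G].
Definition raw_binds (b : tbinds) : binds := [seq (p.1, raw p.2) | p <- b].
Definition tlookup (b : tbinds) (x : nat) : term ar :=
  foldr (fun p r => if p.1 == x then p.2 else r) (Var x) b.
Definition agree (b : tbinds) (s : nat -> term ar) : Prop :=
  forall p, p \in b -> p.2 = s p.1.

Lemma lookup_raw b x : lookup (raw_binds b) x = raw (tlookup b x).
Proof. by elim: b => //= -[y t] b /= ->; case: eqP. Qed.

Lemma rsubst_lookup b t : rsubst (lookup (raw_binds b)) (raw t) = raw (subst (tlookup b) t).
Proof. by rewrite raw_subst; apply: eq_rsubst => x; rewrite lookup_raw. Qed.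

Lemma agree_lookup b s x : agree b s -> x \in unzip1 b -> tlookup b x = s x.
Proof.
elim: b => //= -[y t] b IH h; rewrite inE => xb; case: eqP => /= [<-|/eqP yx].
  exact: (h (y, t)) (mem_head _ _).
apply: IH; first by move=> p pb; apply: h; rewrite inE pb orbT.
by move: xb; rewrite eq_sym (negPf yx).
Qed.

Lemma has_raw_binds b x : has (fun p => p.1 == x) (raw_binds b) = (x \in unzip1 b).
Proof.
elim: b => //= -[y t] b ->; rewrite inE; congr (_ || _); exact: eq_sym.
Qed.

Lemma assignsP xs U b :
  (b \in assigns xs U) = (unzip1 b == xs) && all (fun p => p.2 \in U) b.
Proof.
elim: xs b => [|x xs IH] b /=; first by rewrite inE; case: b => [|[]].
apply/flattenP/idP=> [[s /mapP[z zU ->] /mapP[b' + ->]]|].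
  by rewrite IH /= => /andP[/eqP-> ->]; rewrite eqxx zU.
case: b => [|[y z] b] //=; rewrite eqseq_cons => /andP[/andP[/eqP-> bx] /andP[zU bU]].
exists [seq (x, z) :: b | b <- assigns xs U]; first by apply/mapP; exists z.
by apply/mapP; exists b; rewrite // IH bx.
Qed.

Lemma matches_sound l u b : b \in matches (raw l) (raw u) ->
  exists b0, [/\ b = raw_binds b0, subst (tlookup b0) l = u & unzip1 b0 = vars l].
Proof.
rewrite mem_filter assignsP raw_vars => /andP[/eqP bl /andP[/eqP bd /allP bU]].
have [b0 bE] : exists b0, b = raw_binds b0.
  elim: b bU {bl bd} => [|[x v] b IH] bU; first by exists [::].
  have [|b0 ->] := IH; first by move=> p pb; apply: bU; rewrite inE pb orbT.
  have /mapP[d du /= ->] := bU _ (mem_head _ _).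
  by have [C [w [-> _]]] := raw_decsP du; exists ((x, w) :: b0).
exists b0; split=> //; first by apply: raw_inj; rewrite -rsubst_lookup -bE.
by rewrite -bd bE /unzip1 /raw_binds -map_comp.
Qed.

(** Justifies looking for the value of a variable among the subterms of a known instance, both in
    matching and when a value is read off a reduct. *)
Lemma subterm_plug (s : nat -> term ar) l x : x \in vars l ->
  exists C, subst s l = plug C (s x).
Proof.
elim/term_ffun_ind: l => [y|f a IH] /=.
  by rewrite mem_seq1 => /eqP->; exists (Hole ar).
case/flattenP=> v /mapP[i _ ->] /IH[C E].
exists (CFun i [ffun j => subst s (a j)] C) => /=; congr Fun; apply/ffunP=> j.
by rewrite !ffunE; case: eqP => // ->.
Qed.

Lemma matches_complete l s :
  exists b, [/\ raw_binds b \in matches (raw l) (raw (subst s l)), agree b s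
              & unzip1 b = vars l].
Proof.
pose b := [seq (x, s x) | x <- vars l].
have bs : agree b s by move=> p /mapP[x _ ->].
have b1 : unzip1 b = vars l by rewrite /unzip1 -map_comp map_id.
exists b; split=> //; rewrite mem_filter rsubst_lookup (inj_eq raw_inj).
rewrite (@eq_subst _ s) ?eqxx /=; last by move=> x xl; rewrite (agree_lookup bs) ?b1.
rewrite assignsP raw_vars /unzip1 /raw_binds -map_comp -b1 eqxx /=.
apply/allP=> p /mapP[_ /mapP[x xl ->] ->] /=.
have [C ->] := subterm_plug s xl.
by apply/mapP; exists (raw_ctx C, raw (s x)); rewrite ?mem_raw_decs.
Qed.

End Raw.

(** * Conversions with at most two rule applications *)

Ltac perm_count := let p := fresh "p" in apply/permP => p;
  repeat match goal with H : is_true (perm_eq _ _) |- _ =>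
    move/permP/(_ p): H; do 3 rewrite ?count_cat ?count_rev /=; move=> H end;
  do 3 rewrite ?count_cat ?count_rev /=; lia.

Section Conversion.
Variables (F : countType) (ar : F -> nat).
Implicit Types (s t u w : term ar) (G H es : seq (equation ar)) (e : equation ar)
  (rho : rule ar) (C : ctx ar) (sg : nat -> term ar).

Definition estep e s t : Prop :=
  exists C, (s = plug C e.1 /\ t = plug C e.2) \/ (s = plug C e.2 /\ t = plug C e.1).

Fixpoint chain es s t : Prop :=
  if es is e :: es' then exists2 w, estep e s w & chain es' w t else s = t.

Fixpoint comp_ctx C D : ctx ar :=
  match C with Hole => D | CFun f i a C' => CFun i a (comp_ctx C' D) end.

Lemma plug_comp C D t : plug (comp_ctx C D) t = plug C (plug D t).
Proof.
by elim: C => //= f i a C ->.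
Qed.

Lemma estep_sym e s t : estep e s t -> estep e t s.
Proof. by case=> C [[-> ->]|[-> ->]]; exists C; [right|left]. Qed.

Lemma estep_plug C e s t : estep e s t -> estep e (plug C s) (plug C t).
Proof.
by case=> D [[-> ->]|[-> ->]]; exists (comp_ctx C D); rewrite !plug_comp; [left|right].
Qed.

Lemma chain_cat es1 es2 s t :
  chain (es1 ++ es2) s t <-> exists2 w, chain es1 s w & chain es2 w t.
Proof.
elim: es1 s => [|e es1 IH] s /=.
  by split=> [h|[w -> h]] //; exists s.
split=> [[w ew /IH[x wx xt]]|[x [w ew wx] xt]]; first by exists x => //; exists w.
by exists w => //; apply/IH; exists x.
Qed.

Lemma chain_sym es s t : chain es s t -> chain (rev es) t s.
Proof.
elim: es s => [|e es IH] s /=; first by move=> ->.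
case=> w ew /IH wt; rewrite rev_cons -cats1; apply/chain_cat; exists w => //=.
by exists s => //; exact: estep_sym.
Qed.

Lemma chain_plug C es s t : chain es s t -> chain es (plug C s) (plug C t).
Proof.
elim: es s => [|e es IH] s /=; first by move=> ->.
by case=> w ew /IH wt; exists (plug C w) => //; exact: estep_plug.
Qed.

Lemma hstepsP G s st :
  st \in hsteps (raw_eqs G) (raw s) <->
  exists G1 e G2 t, [/\ G = G1 ++ e :: G2, st = (raw_eqs (G1 ++ G2), raw t) & estep e s t].
Proof.
split.
  case/flattenP=> s1 /mapP[q]; rewrite /raw_eqs splits_map.
  case/mapP=> -[G1 [e G2]]; rewrite splitsP /= => /eqP-> -> {q} ->.
  case/flattenP=> s2 /mapP[d /raw_decsP[C [u [-> ->]]] ->] /=.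
  rewrite mem_cat => /orP[]; case: eqP => // /raw_inj-> ;
    rewrite mem_seq1 -raw_plug => /eqP->.
    exists G1, e, G2, (plug C e.2); split=> //; first by rewrite /raw_eqs map_cat.
    by exists C; left.
  exists G1, e, G2, (plug C e.1); split=> //; first by rewrite /raw_eqs map_cat.
  by exists C; right.
case=> G1 [e [G2 [t [-> -> et]]]]; apply/flattenP.
pose q := (raw_eqs G1, ((raw e.1, raw e.2), raw_eqs G2)).
have qs : q \in splits (raw_eqs (G1 ++ e :: G2)) by rewrite splitsP /raw_eqs map_cat /=.
eexists; first by apply/mapP; exists q; [exact: qs | reflexivity].
apply/flattenP; case: et => C [[-> ->]|[-> ->]]; eexists.
- by apply/mapP; exists (raw_ctx C, raw e.1); [exact: mem_raw_decs | reflexivity].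
- by rewrite mem_cat /= eqxx mem_seq1 /= -raw_plug /raw_eqs map_cat eqxx.
- by apply/mapP; exists (raw_ctx C, raw e.2); [exact: mem_raw_decs | reflexivity].
- by rewrite mem_cat /= eqxx mem_seq1 /= -!raw_plug /raw_eqs map_cat eqxx orbT.
Qed.

Lemma reach_sound G s st : st \in reach (raw_eqs G) (raw s) ->
  exists H t es, [/\ st = (raw_eqs H, raw t), perm_eq G (es ++ H) & chain es s t].
Proof.
rewrite /reach; elim: (size _) st => [|n IH] st /=.
  by rewrite mem_seq1 => /eqP->; exists G, s, [::]; split=> //=.
rewrite mem_cat => /orP[/IH//|/flattenP[sts /mapP[st0 /IH[H [t [es [-> pm ch]]]] ->]]] /=.
case/hstepsP=> G1 [e [G2 [w [HE -> ew]]]]; exists (G1 ++ G2), w, (es ++ [:: e]); split=> //.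
  by move: pm; rewrite HE => pm; perm_count.
by apply/chain_cat; exists t => //=; exists w.
Qed.

(** Each link of the chain consumes a hypothesis, so [size G] rounds suffice; as every round keeps
    the earlier states, shorter chains survive to the last one. *)
Lemma reach_complete G H es s t : perm_eq G (es ++ H) -> chain es s t ->
  exists2 H', perm_eq H' H & (raw_eqs H', raw t) \in reach (raw_eqs G) (raw s).
Proof.
move=> pm ch; rewrite /reach size_map.
pose step (sts : seq (eqs * rt)) := sts ++ flatten [seq hsteps st.1 st.2 | st <- sts].
pose init := [:: (raw_eqs G, raw s)]; rewrite -/init.
have mono n k : {subset iter n step init <= iter (n + k) step init}.
  elim: k => [|k IH] x xn; first by rewrite addn0.
  by rewrite addnS iterS mem_cat IH.
have run : forall es n G0 s0, (raw_eqs G0, raw s0) \in iter n step init ->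
    perm_eq G0 (es ++ H) -> chain es s0 t ->
    exists2 H', perm_eq H' H & (raw_eqs H', raw t) \in iter (n + size es) step init.
  elim=> [|e es' IH] n G0 s0 s0n pm0 /=.
    by move=> <-; exists G0; rewrite ?addn0.
  case=> w ew wt; have eG : e \in G0 by rewrite (perm_mem pm0) mem_head.
  have [G1 [G2 GE]] : exists G1 G2, G0 = G1 ++ e :: G2 by case/splitPr: eG => G1 G2; exists G1, G2.
  have pm' : perm_eq (G1 ++ G2) (es' ++ H) by move: pm0; rewrite GE => pm0; perm_count.
  rewrite addnS -addSn; apply: IH pm' wt; rewrite iterS mem_cat; apply/orP; right.
  apply/flattenP; eexists; first by apply/mapP; exists (raw_eqs G0, raw s0); first exact: s0n.
  by apply/hstepsP; exists G1, e, G2, w.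
have [|H' pH' memH'] := run es 0 G s _ pm ch; first exact: mem_head.
have sz : size es <= size G by rewrite (perm_size pm) size_cat leq_addr.
by exists H' => //; rewrite -(subnKC sz); exact: mono.
Qed.

Lemma conv0bP G s t :
  reflect (exists es H, perm_eq G (es ++ H) /\ chain es s t)
          (conv0b (raw_eqs G) (raw s) (raw t)).
Proof.
apply: (iffP hasP) => [[st /reach_sound[H [w [es [-> pm ch]]]] /eqP/raw_inj wt]|].
  by exists es, H; rewrite -wt.
by case=> es [H [pm /(reach_complete pm)[H' _ h]]]; exists (raw_eqs H', raw t); rewrite /=.
Qed.

Variable R : ctrs ar.

Fixpoint chains (cs : seq (equation ar)) es : Prop :=
  if cs is c :: cs' then
    exists es1 es2, [/\ perm_eq es (es1 ++ es2), chain es1 c.1 c.2 & chains cs' es2]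
  else es = [::].

(* In [sstep1], [fconv1], [sconv1] and [sstep2] the list [es] consists exactly of
   the hypotheses used; unused ones are split off by [within]. *)
Definition sstep1 es s w : Prop :=
  exists rho sg C, [/\ rho \in R, s = plug C (subst sg (lhs rho)),
    w = plug C (subst sg (rhs rho)) & chains (subst_eqs sg (conds rho)) es].

Definition fconv1 es s t : Prop :=
  exists es1 es2 es3 w w', [/\ perm_eq es (es1 ++ es2 ++ es3), chain es1 s w,
    sstep1 es2 w w' & chain es3 w' t].

Definition sconv1 es s t : Prop := fconv1 es s t \/ fconv1 es t s.

Definition sstep2 es s w : Prop :=
  exists rho sg C cs1 c cs2 es1 es2,
  [/\ [/\ rho \in R, s = plug C (subst sg (lhs rho)) & w = plug C (subst sg (rhs rho))],
      conds rho = cs1 ++ c :: cs2, perm_eq es (es1 ++ es2),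
      sconv1 es1 (subst sg c.1) (subst sg c.2)
    & chains (subst_eqs sg (cs1 ++ cs2)) es2].

(** Transitivity with a reflexive conversion under [H] adds 0 to the counter and swallows [H]. *)
Lemma conv_weaken G i s t H : conv R G i s t -> conv R (G ++ H) i s t.
Proof. by move=> h; rewrite -[i]addn0; apply: (conv_trans (perm_refl _) h); exact: conv_refl. Qed.

Lemma conv_perm G G' i s t : perm_eq G G' -> conv R G i s t -> conv R G' i s t.
Proof.
move=> p h; rewrite -[i]addn0; apply: (conv_trans (G1 := G) (G2 := [::]) _ h); last exact: conv_refl.
by rewrite cats0 perm_sym.
Qed.

Lemma chain_conv es s t : chain es s t -> conv R es 0 s t.
Proof.
elim: es s => [|e es IH] s /=; first by move=> ->; exact: conv_refl.
case=> w ew /IH; apply: (conv_trans (i := 0) (G1 := [:: e])); first exact: perm_refl.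
have he : conv R [:: e] 0 e.1 e.2 by apply: (@conv_hyp _ _ R _ [::]); rewrite -surjective_pairing.
by case: ew => C [[-> ->]|[-> ->]]; apply: conv_ctx => //; exact: conv_sym.
Qed.

Lemma chains_convs sg (cs : seq (equation ar)) es : chains (subst_eqs sg cs) es ->
  convs R es 0 [seq subst sg e.1 | e <- cs] [seq subst sg e.2 | e <- cs].
Proof.
elim: cs es => [|c cs IH] es /=; first by move=> ->; exact: convs_nil.
case=> e1 [e2 [p /chain_conv h1 /IH h2]]; exact: (convs_cons p h1 h2).
Qed.

Lemma sstep1_step es s w : sstep1 es s w -> step R es 1 s w.
Proof. by case=> rho [sg [C [rR -> -> /chains_convs h]]]; exact: step_rule. Qed.

Lemma fconv1_conv es s t : fconv1 es s t -> conv R es 1 s t.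
Proof.
case=> e1 [e2 [e3 [w [w' [p /chain_conv h1 /sstep1_step/conv_step h2 /chain_conv h3]]]]].
exact: (conv_trans p h1 (conv_trans (perm_refl _) h2 h3)).
Qed.

Lemma sconv1_conv es s t : sconv1 es s t -> conv R es 1 s t.
Proof. by case=> /fconv1_conv // h; exact: conv_sym. Qed.

Lemma sstep2_step G es H s w : perm_eq G (es ++ H) -> sstep2 es s w -> step R G 2 s w.
Proof.
move=> pG [rho [sg [C [cs1 [c [cs2 [e1 [e2 [[rR -> ->] cE p /sconv1_conv h1 h2]]]]]]]]].
apply: step_rule => //; rewrite cE {rR cE}.
have pG' : perm_eq G ((e1 ++ H) ++ e2).
  by perm_count.
elim: cs1 e2 {p} h2 G {pG} pG' => [|d cs1 IH] e2 /= h2 G pG'.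
  by apply: (convs_cons pG' (conv_weaken _ h1)); exact: chains_convs.
case: h2 => e3 [e4 [p3 /chain_conv h3 /IH h4]].
apply: (convs_cons (i := 0) _ h3 (h4 _ (perm_refl _))).
by perm_count.
Qed.

Definition within (Q : seq (equation ar) -> Prop) G : Prop :=
  exists es H, perm_eq G (es ++ H) /\ Q es.

Lemma conv0_inv G s t : conv R G 0 s t -> within (fun es => chain es s t) G.
Proof.
move En: 0 => n h; elim: h En => {G n s t}.
- move=> G G' s t p _; exists [:: (s, t)], G'; split.
    by perm_count.
  by exists t => //; exists (Hole ar); left.
- by move=> G t _; exists [::], G.
- move=> G i s t _ IH /IH[es [H [p /chain_sym c]]]; exists (rev es), H; split=> //.
  by perm_count.
- move=> G G1 G2 [|i] [|j] s t u p _ IH1 _ IH2 // _.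
  have [es1 [H1 [p1 c1]]] := IH1 erefl; have [es2 [H2 [p2 c2]]] := IH2 erefl.
  exists (es1 ++ es2), (H1 ++ H2); split; first by perm_count.
  by apply/chain_cat; exists t.
- move=> G i s t C _ IH /IH[es [H [p /(chain_plug C) c]]]; by exists es, H.
by move=> G i s t h i0; rewrite -i0 in h; inversion h.
Qed.

Lemma convs0_inv G us vs sg (cs : seq (equation ar)) :
  convs R G 0 us vs -> us = [seq subst sg e.1 | e <- cs] ->
  vs = [seq subst sg e.2 | e <- cs] -> within (chains (subst_eqs sg cs)) G.
Proof.
move En: 0 => n h; elim: h cs En => {G n us vs}.
  by case=> // _ _ _; exists [::], [::].
move=> G G1 G2 [|i] [|j] u v us vs p h _ IH [|c cs] //= _.
have [es1 [H1 [p1 c1]]] := conv0_inv h; case=> uE usE [vE vsE].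
have [es2 [H2 [p2 c2]]] := IH cs erefl usE vsE.
exists (es1 ++ es2), (H1 ++ H2); split; first by perm_count.
by exists es1, es2; rewrite -uE -vE.
Qed.

Lemma step1_inv G s t : step R G 1 s t -> within (fun es => sstep1 es s t) G.
Proof.
move En: 1 => n h; case: h En => {n s t} {}G i rho sg C rR + [i0].
rewrite -i0 => /(@convs0_inv _ _ _ sg (conds rho))/(_ erefl erefl)[es [H [p c]]].
by exists es, H; split=> //; exists rho, sg, C.
Qed.

Lemma sstep1_plug C es s t : sstep1 es s t -> sstep1 es (plug C s) (plug C t).
Proof.
by case=> rho [sg [D [rR -> -> c]]]; exists rho, sg, (comp_ctx C D); rewrite !plug_comp.
Qed.

Lemma fconv1_plug C es s t : fconv1 es s t -> fconv1 es (plug C s) (plug C t).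
Proof.
case=> e1 [e2 [e3 [w [w' [p /(chain_plug C) c1 /(sstep1_plug C) h /(chain_plug C) c2]]]]].
by exists e1, e2, e3, (plug C w), (plug C w').
Qed.

Lemma sconv1_sym es s t : sconv1 es s t -> sconv1 es t s.
Proof. by case; [right|left]. Qed.

(** If the rule is applied against the direction of reading, the conversion starts at [t], so the
    chain is attached reversed at its far end. *)
Lemma chain_sconv1 (e1 e2 : seq (equation ar)) es s w t :
  perm_eq es (e1 ++ e2) -> chain e1 s w -> sconv1 e2 w t -> sconv1 es s t.
Proof.
move=> p c [] [a1 [a2 [a3 [x [x' [q c1 h c3]]]]]]; [left|right].
  exists (e1 ++ a1), a2, a3, x, x'; split=> //; first by perm_count.
  by apply/chain_cat; exists w.
exists a1, a2, (a3 ++ rev e1), x, x'; split=> //; first by perm_count.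
by apply/chain_cat; exists w => //; exact: chain_sym.
Qed.

Lemma sstep1_sconv1 es s t : sstep1 es s t -> sconv1 es s t.
Proof. by move=> h; left; exists [::], es, [::], s, t; rewrite cats0. Qed.

Lemma conv1_inv G s t : conv R G 1 s t -> within (fun es => sconv1 es s t) G.
Proof.
move En: 1 => n h; elim: h En => {G n s t} //.
- by move=> G i s t _ IH /IH[es [H [p /sconv1_sym c]]]; exists es, H.
- move=> G G1 G2 i j s t u p h1 IH1 h2 IH2 ij.
  (* Exactly one of the two halves contains the rule application; the other is a chain of
     hypotheses. *)
  have [] : (i = 0 /\ j = 1) \/ (i = 1 /\ j = 0) by lia.
    case=> i0 j1; subst i j.
    have [es1 [H1 [p1 c1]]] := conv0_inv h1; have [es2 [H2 [p2 c2]]] := IH2 erefl.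
    exists (es1 ++ es2), (H1 ++ H2); split; first by perm_count.
    exact: chain_sconv1 (perm_refl _) c1 c2.
  case=> i1 j0; subst i j.
  have [es1 [H1 [p1 c1]]] := IH1 erefl; have [es2 [H2 [p2 c2]]] := conv0_inv h2.
  exists (rev es2 ++ es1), (H1 ++ H2); split; first by perm_count.
  by apply/sconv1_sym/(chain_sconv1 (perm_refl _) (chain_sym c2))/sconv1_sym.
- move=> G i s t C _ IH /IH[es [H [p [] /(fconv1_plug C) c]]]; exists es, H;
  by split=> //; first [by left | by right].
move=> G i s t h i1; rewrite -i1 in h.
by have [es [H [p /sstep1_sconv1 c]]] := step1_inv h; exists es, H.
Qed.

Lemma convs1_inv G us vs sg (cs : seq (equation ar)) :
  convs R G 1 us vs -> us = [seq subst sg e.1 | e <- cs] ->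
  vs = [seq subst sg e.2 | e <- cs] ->
  exists cs1 c cs2 es1 es2 H, [/\ cs = cs1 ++ c :: cs2, perm_eq G (es1 ++ es2 ++ H),
    sconv1 es1 (subst sg c.1) (subst sg c.2) & chains (subst_eqs sg (cs1 ++ cs2)) es2].
Proof.
move En: 1 => n h; elim: h cs En => {G n us vs} //.
move=> G G1 G2 i j u v us vs p h1 h2 IH [|c cs] //= ij [uE usE] [vE vsE].
have [] : (i = 0 /\ j = 1) \/ (i = 1 /\ j = 0) by lia.
  case=> i0 j1; subst i j.
  have [es1 [H1 [p1 c1]]] := conv0_inv h1.
  have [cs1 [d [cs2 [es2 [es3 [H [-> p2 c2 c3]]]]]]] := IH cs erefl usE vsE.
  exists (c :: cs1), d, cs2, es2, (es1 ++ es3), (H1 ++ H); split=> //; first by perm_count.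
  by exists es1, es3; rewrite /= -uE -vE.
case=> i1 j0; subst i j.
have [es1 [H1 [p1 c1]]] := conv1_inv h1.
have [es2 [H2 [p2 c2]]] := convs0_inv h2 usE vsE.
exists [::], c, cs, es1, es2, (H1 ++ H2); rewrite -uE -vE; split=> //.
by perm_count.
Qed.

Lemma step2_inv G s t : step R G 2 s t -> within (fun es => sstep2 es s t) G.
Proof.
move En: 2 => n h; case: h En => {n s t} {}G i rho sg C rR + [i0].
rewrite -i0 => /(@convs1_inv _ _ _ sg (conds rho))/(_ erefl erefl).
case=> cs1 [c [cs2 [es1 [es2 [H [cE p c1 c2]]]]]].
exists (es1 ++ es2), H; rewrite -catA; split=> //.
by exists rho, sg, C, cs1, c, cs2, es1, es2.
Qed.

(** A step has counter at least 1, so the alternatives are the counter pairs (1, 0), (1, 1) and (2,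
    0). *)
Definition sstep_conv es s t : Prop :=
  exists w es1 es2, perm_eq es (es1 ++ es2) /\
  [\/ sstep1 es1 s w /\ chain es2 w t, sstep1 es1 s w /\ sconv1 es2 w t
    | sstep2 es1 s w /\ chain es2 w t].

Lemma step_conv_within G s t :
  (exists i j, i + j <= 2 /\ step_conv R G i j s t) <-> within (fun es => sstep_conv es s t) G.
Proof.
split.
  case=> -[|[|[|i]]] [j [ij [w [G1 [G2 [p h1 h2]]]]]] //; first by inversion h1.
    have [es1 [H1 [p1 c1]]] := step1_inv h1; case: j ij h2 => [|[|//]] _.
      case/conv0_inv=> es2 [H2 [p2 c2]]; exists (es1 ++ es2), (H1 ++ H2).
      by split; [perm_count | exists w, es1, es2; split=> //; apply: Or31].
    case/conv1_inv=> es2 [H2 [p2 c2]]; exists (es1 ++ es2), (H1 ++ H2).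
    by split; [perm_count | exists w, es1, es2; split=> //; apply: Or32].
  have [es1 [H1 [p1 c1]]] := step2_inv h1; case: j ij h2 => [_|//].
  case/conv0_inv=> es2 [H2 [p2 c2]]; exists (es1 ++ es2), (H1 ++ H2).
  by split; [perm_count | exists w, es1, es2; split=> //; apply: Or33].
case=> es [H [p [w [es1 [es2 [p' h]]]]]].
have pG : perm_eq G (es1 ++ (es2 ++ H)) by perm_count.
case: h => -[h1 h2].
- exists 1, 0; split=> //; exists w, es1, (es2 ++ H); split=> //; first exact: sstep1_step.
  by apply: conv_weaken; exact: chain_conv.
- exists 1, 1; split=> //; exists w, es1, (es2 ++ H); split=> //; first exact: sstep1_step.
  by apply: conv_weaken; exact: sconv1_conv.
- exists 2, 0; split=> //; exists w, es1, (es2 ++ H); split=> //.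
    by apply: (sstep2_step (H := [::]) _ h1); rewrite cats0.
  by apply: conv_weaken; exact: chain_conv.
Qed.

Lemma ccp_joinable_within G s t : ccp_joinable R G s t <->
  [\/ within (fun es => chain es s t) G \/ within (fun es => sconv1 es s t) G,
      within (fun es => sstep2 es s t) G \/ within (fun es => sstep2 es t s) G
    | within (fun es => sstep_conv es s t) G /\ within (fun es => sstep_conv es t s) G].
Proof.
split.
  case=> [[/conv0_inv h|/conv1_inv h]|[/step2_inv h|/step2_inv h]|
    [/step_conv_within h1 /step_conv_within h2]].
  - by apply: Or31; left.
  - by apply: Or31; right.
  - by apply: Or32; left.
  - by apply: Or32; right.
  - by apply: Or33.
case=> [[] [es [H [p h]]]|[] [es [H [p h]]]|[/step_conv_within h1 /step_conv_within h2]].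
- apply: Or31; left; apply: (@conv_perm (es ++ H)); first by rewrite perm_sym.
  by apply: conv_weaken; exact: chain_conv.
- apply: Or31; right; apply: (@conv_perm (es ++ H)); first by rewrite perm_sym.
  by apply: conv_weaken; exact: sconv1_conv.
- by apply: Or32; left; exact: sstep2_step p h.
- by apply: Or32; right; exact: sstep2_step p h.
- by apply: Or33.
Qed.

End Conversion.

(** * Soundness and completeness of the searches for embedded terms *)

Section Search.
Variables (F : countType) (ar : F -> nat).
Implicit Types (s t u w z : term ar) (G H es : seq (equation ar))
  (rho : rule ar) (C : ctx ar) (b : seq (nat * term ar)).

Definition raw_conds (cs : seq (equation ar)) : seq rcond :=
  [seq (raw c.1, (raw c.2, tt)) | c <- cs].
Definition raw_rule rho : rrule :=
  (raw (lhs rho), (raw (rhs rho), (raw_conds (conds rho), tt))).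

Definition var_eqs (xys : seq (nat * nat)) : seq (equation ar) :=
  [seq (Var xy.1, Var xy.2) | xy <- xys].

Lemma thread1_sound x y G b st :
  st \in thread1 (RV x, (RV y, tt)) (raw_eqs G, raw_binds b) ->
  exists H z es, [/\ st = (raw_eqs H, raw_binds ((y, z) :: b)), perm_eq G (es ++ H),
    chain es (tlookup b x) z & (y \in unzip1 b -> tlookup b y = z)].
Proof.
rewrite /thread1 /= rsubst_Var rvar_Var !lookup_raw => /mapP[g].
rewrite mem_filter has_raw_binds => /andP[gy /reach_sound[H [z [es [gE p c]]]] ->].
exists H, z, es; rewrite gE /=; split=> // yb; move: gy; rewrite yb gE /=.
by move=> /eqP/raw_inj.
Qed.

Lemma thread1_complete x y G H es z b :
  perm_eq G (es ++ H) -> chain es (tlookup b x) z ->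
  (y \in unzip1 b -> tlookup b y = z) ->
  exists2 H', perm_eq H' H &
    (raw_eqs H', raw_binds ((y, z) :: b))
      \in thread1 (RV x, (RV y, tt)) (raw_eqs G, raw_binds b).
Proof.
move=> p /(reach_complete p)[H' pH' mem] yb; exists H' => //.
rewrite /thread1 /= rsubst_Var rvar_Var !lookup_raw; apply/mapP; exists (raw_eqs H', raw z) => //.
rewrite mem_filter mem andbT has_raw_binds.
by case: ifP => // /yb ->.
Qed.

Lemma subst_var_eqs (sg1 sg2 : nat -> term ar) xys :
  {in unzip1 xys ++ unzip2 xys, sg1 =1 sg2} ->
  subst_eqs sg1 (var_eqs xys) = subst_eqs sg2 (var_eqs xys).
Proof.
move=> e; rewrite /subst_eqs /var_eqs -!map_comp; apply/eq_in_map => xy h /=.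
by rewrite !e // mem_cat ?(map_f fst h) // (map_f snd h) orbT.
Qed.

(** A repeated binding passes the consistency check of [thread1], so prepending it changes no value
    looked up before, and the conditions solved so far stay solved. *)
Lemma thread_sound xys G b st :
  {subset unzip1 xys <= unzip1 b} ->
  st \in thread (raw_conds (var_eqs xys)) (raw_eqs G) (raw_binds b) ->
  exists H b' es, [/\ st = (raw_eqs H, raw_binds b'), perm_eq G (es ++ H),
    {subset unzip1 b ++ unzip2 xys <= unzip1 b'}, {in unzip1 b, tlookup b' =1 tlookup b}
    & chains (subst_eqs (tlookup b') (var_eqs xys)) es].
Proof.
elim: xys st => [|[x y] xys IH] st sub.
  rewrite mem_seq1 => /eqP->; exists G, b, [::]; split=> //.
  by move=> x; rewrite cats0.
case/flattenP=> sts /mapP[st1 st1in ->].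
have xsub : {subset unzip1 xys <= unzip1 b} by move=> v vin; apply: sub; rewrite inE vin orbT.
have xb : x \in unzip1 b by apply: sub; rewrite mem_head.
have [H1 [b1 [es1 [-> p1 sub1 eq1 c1]]]] := IH _ xsub st1in.
case/thread1_sound=> H [z [es [-> p c yz]]].
have eqb : {in unzip1 b1, tlookup ((y, z) :: b1) =1 tlookup b1}.
  by move=> v vb /=; case: eqP => // yv; rewrite -yv in vb *; rewrite yz.
have bb1 v : v \in unzip1 b -> v \in unzip1 b1 by move=> vb; apply: sub1; rewrite mem_cat vb.
exists H, ((y, z) :: b1), (es ++ es1); split=> //; first by perm_count.
- move=> v; rewrite mem_cat [v \in unzip2 _]inE [v \in unzip1 (_ :: _)]inE /= orbCA.
  by case: eqP => //= _; rewrite -mem_cat => /sub1.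
- by move=> v vb; rewrite eqb ?eq1 ?bb1.
exists es, es1; split; first exact: perm_refl.
  have -> : subst (tlookup ((y, z) :: b1)) (Var x) = tlookup b1 x by exact: eqb (bb1 _ xb).
  by rewrite /= eqxx.
rewrite -/(subst_eqs _ (var_eqs xys)) (@subst_var_eqs _ (tlookup b1)) //.
move=> v; rewrite mem_cat => vin; apply: eqb; case/orP: vin => [/xsub/bb1//|vy].
by apply: sub1; rewrite mem_cat vy orbT.
Qed.

(** The search is followed along the given solution [sg]: all bindings agree with it, hence every
    consistency check succeeds. *)
Lemma thread_complete sg xys G H es b :
  {subset unzip1 xys <= unzip1 b} -> agree b sg ->
  chains (subst_eqs sg (var_eqs xys)) es -> perm_eq G (es ++ H) ->
  exists H' b', [/\ perm_eq H' H, agree b' sg,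
    {subset unzip1 b ++ unzip2 xys <= unzip1 b'}
    & (raw_eqs H', raw_binds b')
        \in thread (raw_conds (var_eqs xys)) (raw_eqs G) (raw_binds b)].
Proof.
elim: xys H es => [|[x y] xys IH] H es sub ag.
  move=> /= -> p; exists G, b; split=> //; last exact: mem_head.
  by move=> v; rewrite cats0.
case=> es1 [es2 [p12 c1 c2]] p.
have xsub : {subset unzip1 xys <= unzip1 b} by move=> v vin; apply: sub; rewrite inE vin orbT.
have xb : x \in unzip1 b by apply: sub; rewrite mem_head.
have [|H1 [b1 [pH1 ag1 sub1 mem1]]] := IH (es1 ++ H) es2 xsub ag c2; first by perm_count.
have bb1 v : v \in unzip1 b -> v \in unzip1 b1 by move=> vb; apply: sub1; rewrite mem_cat vb.
have [|yb|H' pH' mem'] := @thread1_complete x y H1 H es1 (sg y) b1 pH1.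
- by rewrite (agree_lookup ag1 (bb1 _ xb)).
- exact: agree_lookup.
exists H', ((y, sg y) :: b1); split=> //.
- by move=> q; rewrite inE => /orP[/eqP->|/ag1].
- move=> v; rewrite mem_cat [v \in unzip2 _]inE [v \in unzip1 (_ :: _)]inE /= orbCA.
  by case: eqP => //= _; rewrite -mem_cat => /sub1.
by apply/flattenP; eexists; [apply/mapP; eexists; [exact: mem1 | reflexivity] | exact: mem'].
Qed.

Variable R : ctrs ar.
Hypothesis lrR : lr_separated R.
Local Notation rawR := (map raw_rule R).

Lemma lr_rule rho : rho \in R -> exists xys,
  [/\ conds rho = var_eqs xys, vars (lhs rho) =i unzip1 xys,
      {subset vars (rhs rho) <= unzip2 xys}
    & forall v, v \in unzip1 xys -> v \in unzip2 xys -> False].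
Proof.
move/lrR=> [xys [cE _ [lE _] rE disj]]; exists xys; split=> //.
by move=> v v1 v2; move: (disj v); rewrite v1 v2.
Qed.

Lemma step1s_sound G s st : st \in step1s rawR (raw_eqs G) (raw s) ->
  exists H w es, [/\ st = (raw_eqs H, raw w), perm_eq G (es ++ H) & sstep1 R es s w].
Proof.
case/flattenP=> s1 /mapP[_ /mapP[rho rR ->] ->].
case/flattenP=> s2 /mapP[d /raw_decsP[C [u [-> ->]]] ->].
case/flattenP=> s3 /mapP[b' /matches_sound[b [-> luE b1]] ->].
case/mapP=> st' + ->; have [xys [cE lE rE disj]] := lr_rule rR.
rewrite /raw_rule /= cE => /thread_sound[|H [b2 [es [-> p sub eqb c]]]].
  by move=> v; rewrite b1 lE.
exists H, (plug C (subst (tlookup b2) (rhs rho))), es; split=> //.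
  by rewrite /= rsubst_lookup raw_plug.
exists rho, (tlookup b2), C; rewrite cE; split=> //; congr plug; rewrite -luE.
by apply/eq_subst => v vl; rewrite eqb // b1.
Qed.

Lemma step1s_complete G H es s w : perm_eq G (es ++ H) -> sstep1 R es s w ->
  exists2 H', perm_eq H' H & (raw_eqs H', raw w) \in step1s rawR (raw_eqs G) (raw s).
Proof.
move=> p [rho [sg [C [rR -> -> c]]]]; have [xys [cE lE rE disj]] := lr_rule rR.
have [b [bm ag b1]] := matches_complete (lhs rho) sg.
rewrite cE in c; have [|H' [b' [pH' ag' sub' mem']]] := thread_complete _ ag c p.
  by move=> v; rewrite b1 lE.
exists H' => //.
apply/flattenP; eexists; first by apply/mapP; eexists; [exact: map_f rR | reflexivity].
apply/flattenP; eexists; first by apply/mapP; eexists; [exact: mem_raw_decs | reflexivity].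
apply/flattenP; eexists; first by apply/mapP; eexists; [exact: bm | reflexivity].
apply/mapP; eexists; first by rewrite /= cE; exact: mem'.
rewrite /= rsubst_lookup -raw_plug; congr (_, raw (plug _ _)).
apply/esym/eq_subst => v vr; apply: (agree_lookup ag'); apply: sub'.
by rewrite mem_cat rE ?orbT.
Qed.

Lemma fwd1bP G s t :
  reflect (within (fun es => fconv1 R es s t) G) (fwd1b rawR (raw_eqs G) (raw s) (raw t)).
Proof.
apply: (iffP hasP).
  case=> g1 /reach_sound[H1 [w [es1 [-> p1 c1]]]] /hasP[g2].
  case/step1s_sound=> H2 [w' [es2 [-> p2 c2]]] /conv0bP[es3 [H3 [p3 c3]]].
  exists (es1 ++ es2 ++ es3), H3; split; first by perm_count.
  by exists es1, es2, es3, w, w'.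
case=> es [H [p [es1 [es2 [es3 [w [w' [p' c1 c2 c3]]]]]]]].
have [|H1 pH1 m1] := @reach_complete _ _ G (es2 ++ es3 ++ H) es1 s w _ c1; first by perm_count.
have [|H2 pH2 m2] := @step1s_complete H1 (es3 ++ H) es2 w w' _ c2; first by perm_count.
exists (raw_eqs H1, raw w) => //; apply/hasP; exists (raw_eqs H2, raw w') => //.
by apply/conv0bP; exists es3, H.
Qed.

Lemma conv1bP G s t :
  reflect (within (fun es => sconv1 R es s t) G) (conv1b rawR (raw_eqs G) (raw s) (raw t)).
Proof.
apply: (iffP orP) => [[]/fwd1bP[es [H [p c]]]|[es [H [p [] c]]]].
- by exists es, H; split=> //; left.
- by exists es, H; split=> //; right.
- by left; apply/fwd1bP; exists es, H.
- by right; apply/fwd1bP; exists es, H.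
Qed.

Lemma tlookup_cat b b' v :
  tlookup (b ++ b') v = if v \in unzip1 b then tlookup b v else tlookup b' v.
Proof. by elim: b => //= -[y z] b ->; rewrite inE [v == y]eq_sym; case: eqP. Qed.

Lemma var_eqs_split xys cs1 c cs2 : var_eqs xys = cs1 ++ c :: cs2 ->
  exists xys1 x y xys2, [/\ xys = xys1 ++ (x, y) :: xys2, cs1 = var_eqs xys1,
    c = (Var x, Var y) & cs2 = var_eqs xys2].
Proof.
elim: xys cs1 => [|[x y] xys IH] [|d cs1] //= [].
  by move=> <- <-; exists [::], x, y, xys.
move=> <- /IH[xys1 [x' [y' [xys2 [-> -> -> ->]]]]].
by exists ((x, y) :: xys1), x', y', xys2.
Qed.

Lemma step2b_sound G s w : step2b rawR (raw_eqs G) (raw s) (raw w) ->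
  within (fun es => sstep2 R es s w) G.
Proof.
case/hasP=> _ /mapP[rho rR ->] /hasP[d /raw_decsP[C [u [-> ->]]]].
case/hasP=> b' /matches_sound[b [-> luE b1]] /hasP[q].
have [xys [cE lE rE disj]] := lr_rule rR.
rewrite /raw_rule /= cE /raw_conds splits_map => /mapP[[cs1 [c cs2]]].
rewrite splitsP /= => /eqP/var_eqs_split[xys1 [x [y [xys2 [xE -> -> ->]]]]] -> {q} /=.
rewrite -map_cat -/(raw_conds _) [var_eqs _ ++ _](_ : _ = var_eqs (xys1 ++ xys2));
  last by rewrite /var_eqs map_cat.
have lsub v : v \in unzip1 (xys1 ++ xys2) ++ [:: x] -> v \in vars (lhs rho).
  rewrite lE xE /unzip1 !map_cat !mem_cat /= !inE.
  by case: (v \in _); case: (v \in _); case: (v == x).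
have bsub : {subset unzip1 (xys1 ++ xys2) <= unzip1 b}.
  by move=> v vx; rewrite b1 lsub // mem_cat vx.
case/hasP=> st /(thread_sound bsub)[H [b2 [es [-> p sub eqb c2]]]] /=.
rewrite has_raw_binds rvar_Var lookup_raw.
have sub1 v : v \in unzip1 b -> v \in unzip1 b2 by move=> vb; apply: sub; rewrite mem_cat vb.
have sub2 v : v \in unzip2 (xys1 ++ xys2) -> v \in unzip1 b2.
  by move=> vb; apply: sub; rewrite mem_cat vb orbT.
have xb : x \in unzip1 b by rewrite b1 lsub // mem_cat mem_head orbT.
case/hasP=> z' z'in /andP[]; have [z zE yz] :
    exists2 z, z' = raw z & (y \in unzip1 b2 -> tlookup b2 y = z).
  move: z'in; case: ifP => [yb2|yb2]; first by rewrite mem_seq1 => /eqP->; eexists.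
  by case/mapP=> d' /raw_decsP[C' [u' [-> _]]] ->; exists u'.
rewrite {}zE {z' z'in} rsubst_Var lookup_raw -[map _ R]/rawR => /conv1bP[es1 [H1 [p1 c1]]].
rewrite (_ : raw_binds b2 ++ _ = raw_binds (b2 ++ [:: (y, z)])); last by rewrite /raw_binds map_cat.
rewrite rsubst_lookup -raw_plug => /eqP/raw_inj wE.
(* Placed last, the new pair matters only if [b2] leaves [y] unbound; otherwise [z] is the value
   that [b2] gives to [y]. *)
pose sg := tlookup (b2 ++ [:: (y, z)]).
have sgE v : v \in unzip1 b2 -> sg v = tlookup b2 v by move=> vb; rewrite /sg tlookup_cat vb.
exists (es1 ++ es), H1; split; first by perm_count.
exists rho, sg, C, (var_eqs xys1), (Var x, Var y), (var_eqs xys2), es1, es; split=> //.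
- split=> //; congr plug; rewrite -luE; apply/eq_subst => v vl.
  by rewrite sgE ?eqb ?sub1 ?b1.
- by rewrite cE xE /var_eqs map_cat.
- rewrite /= sgE ?sub1 //; suff -> : sg y = z by [].
  by rewrite /sg tlookup_cat; case: ifP => [/yz//|_]; rewrite /= eqxx.
rewrite (_ : var_eqs xys1 ++ _ = var_eqs (xys1 ++ xys2)); last by rewrite /var_eqs map_cat.
rewrite (@subst_var_eqs _ (tlookup b2)) // => v; rewrite mem_cat => /orP[/bsub/sub1|/sub2];
  exact: sgE.
Qed.

Lemma step2b_complete G H es s w : perm_eq G (es ++ H) -> sstep2 R es s w ->
  step2b rawR (raw_eqs G) (raw s) (raw w) \/ within (fun es => sstep1 R es s w) G.
Proof.
move=> p [rho [sg [C [cs1 [c [cs2 [es1 [es2 [[rR -> ->] cE p' c1 c2]]]]]]]]].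
have [xys [cE' lE rE disj]] := lr_rule rR.
move: (cE); rewrite cE' => /var_eqs_split[xys1 [x [y [xys2 [xE cs1E c_E cs2E]]]]]; subst c.
rewrite cs1E cs2E (_ : _ ++ _ = var_eqs (xys1 ++ xys2)) in c2; last by rewrite /var_eqs map_cat.
have lsub v : v \in unzip1 (xys1 ++ xys2) ++ [:: x] -> v \in vars (lhs rho).
  rewrite lE xE /unzip1 !map_cat !mem_cat /= !inE.
  by case: (v \in _); case: (v \in _); case: (v == x).
have [|yb] := boolP ((y \in unzip2 (xys1 ++ xys2)) || (y \in vars (rhs rho))); last first.
  (* [y] occurs nowhere else, so it may be instantiated like [x], which turns
     the remaining condition into a trivial one. *)
  right; move: yb; rewrite negb_or => /andP[y2 yr].
  pose sg' v := if v == y then sg x else sg v.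
  (* Disjointness of the x_i and the y_i enters here: redefining [y] changes neither the left-hand
     side nor the value of [x]. *)
  have yNx v : v \in unzip1 xys -> v == y = false.
    move=> vx; apply/eqP => vy; apply: (disj v) => //.
    by rewrite vy xE /unzip2 map_cat mem_cat mem_head orbT.
  exists es2, (es1 ++ H); split; first by perm_count.
  exists rho, sg', C; split=> //.
  - by congr plug; apply/eq_subst => v; rewrite lE => vx; rewrite /sg' yNx.
  - congr plug; apply/eq_subst => v vr; rewrite /sg'; case: eqP => // vy.
    by rewrite -vy vr in yr.
  have sgE v : v \in unzip1 (xys1 ++ xys2) ++ unzip2 (xys1 ++ xys2) -> sg v = sg' v.
    rewrite mem_cat /sg' => /orP[vx|vy]; last by case: eqP vy y2 => // -> ->.
    by rewrite yNx // -lE lsub // mem_cat vx.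
  rewrite (subst_var_eqs sgE) in c2; rewrite cE'.
  (* A trivial condition is solved by the empty chain and takes no hypotheses. *)
  have chains_insert cs d cs' e : d.1 = d.2 -> chains (cs ++ cs') e -> chains (cs ++ d :: cs') e.
    move=> dE; elim: cs e => [|a cs IH] e /=; first by exists [::], e.
    by case=> e1 [e2 [q h1 /IH h2]]; exists e1, e2.
  rewrite xE /var_eqs /subst_eqs !map_cat /= in c2 *; apply: chains_insert c2 => /=.
  by rewrite /sg' eqxx yNx // xE /unzip1 map_cat mem_cat mem_head orbT.
move=> yb; left.
have [b [bm ag b1]] := matches_complete (lhs rho) sg.
have bsub : {subset unzip1 (xys1 ++ xys2) <= unzip1 b}.
  by move=> v vx; rewrite b1 lsub // mem_cat vx.
have [|H' [b2 [pH' ag2 sub mem2]]] := thread_complete (H := es1 ++ H) (G := G) bsub ag c2.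
  by perm_count.
have sub1 v : v \in unzip1 b -> v \in unzip1 b2 by move=> vb; apply: sub; rewrite mem_cat vb.
have sub2 v : v \in unzip2 (xys1 ++ xys2) -> v \in unzip1 b2.
  by move=> vb; apply: sub; rewrite mem_cat vb orbT.
have xb : x \in unzip1 b by rewrite b1 lsub // mem_cat mem_head orbT.
apply/hasP; exists (raw_rule rho); first exact: map_f.
apply/hasP; exists (raw_ctx C, raw (subst sg (lhs rho))); first exact: mem_raw_decs.
apply/hasP; exists (raw_binds b) => //.
apply/hasP; exists (raw_conds (var_eqs xys1), ((RV x, (RV y, tt)), raw_conds (var_eqs xys2))).
  by rewrite /= cE' xE splitsP /raw_conds /var_eqs !map_cat.
apply/hasP; exists (raw_eqs H', raw_binds b2).
  rewrite /= [_ ++ _](_ : _ = raw_conds (var_eqs (xys1 ++ xys2))) //.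
  by rewrite /raw_conds /var_eqs !map_cat.
apply/hasP; exists (raw (sg y)).
  rewrite /= has_raw_binds rvar_Var lookup_raw; case: ifP => yb2.
    by rewrite mem_seq1 (agree_lookup ag2 yb2).
  case/orP: yb => [/sub2|yr]; first by rewrite yb2.
  have [D E] := subterm_plug sg yr.
  rewrite E -plug_comp; apply/mapP.
  by exists (raw_ctx (comp_ctx C D), raw (sg y)); rewrite ?mem_raw_decs.
have ag3 : agree (b2 ++ [:: (y, sg y)]) sg.
  by move=> q; rewrite mem_cat mem_seq1 => /orP[/ag2|/eqP->].
apply/andP; split.
  rewrite /= rsubst_Var lookup_raw (agree_lookup ag2 (sub1 _ xb)).
  by apply/conv1bP; exists es1, H; split.
rewrite /= rvar_Var (_ : raw_binds b2 ++ _ = raw_binds (b2 ++ [:: (y, sg y)])); last first.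
  by rewrite /raw_binds map_cat.
rewrite rsubst_lookup -raw_plug (@eq_subst _ _ _ sg) // => v /rE vr.
apply: (agree_lookup ag3); move: vr; rewrite xE /unzip2 map_cat mem_cat /= inE => vr.
rewrite /unzip1 map_cat mem_cat /= mem_seq1; case: eqP vr => [_ _|_ /= vr]; first by rewrite orbT.
by rewrite orbF; apply: sub2; rewrite /unzip2 map_cat mem_cat.
Qed.

Lemma step_convbP G s t :
  reflect (within (fun es => sstep_conv R es s t) G) (step_convb rawR (raw_eqs G) (raw s) (raw t)).
Proof.
apply: (iffP orP) => [[]/hasP[g]|].
- case/step1s_sound=> H [w [es1 [-> p h]]] /orP[/conv0bP|/conv1bP] [es2 [H2 [p2 h2]]];
    (exists (es1 ++ es2), H2; split; first by perm_count); exists w, es1, es2; split=> //.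
    by apply: Or31.
  by apply: Or32.
- case/reach_sound=> H [w [es2 [-> p2 /chain_sym c]]] /step2b_sound[es1 [H1 [p1 h]]].
  exists (es1 ++ rev es2), H1; split; first by perm_count.
  by exists w, es1, (rev es2); split=> //; apply: Or33.
case=> es [H [p [w [es1 [es2 [p' h]]]]]].
have one es1' es2' H1 : perm_eq G (es1' ++ es2' ++ H1) -> sstep1 R es1' s w ->
    chain es2' w t \/ sconv1 R es2' w t ->
    has (fun g => conv0b g.1 g.2 (raw t) || conv1b rawR g.1 g.2 (raw t))
      (step1s rawR (raw_eqs G) (raw s)).
  move=> q h1 h2; have [H' pH' mem'] := step1s_complete q h1.
  apply/hasP; exists (raw_eqs H', raw w) => //.
  by apply/orP; case: h2 => h2; [left; apply/conv0bP | right; apply/conv1bP];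
    exists es2', H1.
case: h => -[h1 h2].
- by left; apply: (one es1 es2 H) => //; [perm_count | left].
- by left; apply: (one es1 es2 H) => //; [perm_count | right].
have [|H' pH' mem'] := reach_complete (G := G) (H := es1 ++ H) _ (chain_sym h2).
  by perm_count.
have [|st2|[es3 [H3 [p3 st1]]]] := step2b_complete (G := H') (H := H) _ h1; first by perm_count.
  by right; apply/hasP; exists (raw_eqs H', raw w).
(* A collapsed nested step turns the counter pair (2, 0) into (1, 0), which the search from [s]
   covers. *)
by left; apply: (one es3 es2 H3) => //; [perm_count | left].
Qed.

Lemma joinablebP G s t :
  reflect (ccp_joinable R G s t) (joinableb rawR (raw_eqs G) (raw s) (raw t)).
Proof.
apply: (iffP idP).
  move=> h; apply/ccp_joinable_within.
  case/or4P: h => [/conv0bP h|/conv1bP h|/step2b_sound h|/orP[/step2b_sound h|h]].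
  - by apply: Or31; left.
  - by apply: Or31; right.
  - by apply: Or32; left.
  - by apply: Or32; right.
  by case/andP: h => /step_convbP h1 /step_convbP h2; apply: Or33.
have one w w' : within (fun es => sstep1 R es w w') G -> within (fun es => sconv1 R es w w') G.
  by case=> es [H [p /sstep1_sconv1 h]]; exists es, H.
move/ccp_joinable_within; rewrite /joinableb.
case=> [[/conv0bP->//|/conv1bP->]|[] [es [H [p /(step2b_complete p)[->|/one]]]]|
  [/step_convbP-> /step_convbP->]];
  rewrite ?orbT //.
  by move/conv1bP->; rewrite orbT.
case=> es' [H' [p' /sconv1_sym h]]; have /conv1bP-> : within (fun es => sconv1 R es s t) G.
  by exists es', H'.
by rewrite orbT.
Qed.

End Search.

(** * Unification and critical pairs *)

Scheme conv_mind := Minimality for conv Sort Prop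
  with step_mind := Minimality for step Sort Prop
  with convs_mind := Minimality for convs Sort Prop.
Combined Scheme conv_mutind from conv_mind, step_mind, convs_mind.

Lemma rsize_Fun f ts : rsize (RF f ts) = (sumn (map rsize ts)).+1.
Proof. by rewrite /rsize /= -map_comp. Qed.

Section CriticalPairs.
Variables (F : countType) (ar : F -> nat).
Implicit Types (s t u : term ar) (G : seq (equation ar)) (e : equation ar)
  (C : ctx ar) (R : ctrs ar)
  (rho : rule ar) (tau sg : nat -> term ar) (b : seq (nat * term ar)).

Lemma subst_comp tau sg t : subst tau (subst sg t) = subst (fun x => subst tau (sg x)) t.
Proof.
elim/term_ffun_ind: t => //= f a IH; congr Fun; apply/ffunP=> i.
by rewrite !ffunE IH.
Qed.

Fixpoint subst_ctx sg C : ctx ar :=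
  match C with
  | Hole => Hole ar
  | CFun f i a D => CFun i [ffun j => subst sg (a j)] (subst_ctx sg D)
  end.

Lemma subst_plug sg C t : subst sg (plug C t) = plug (subst_ctx sg C) (subst sg t).
Proof.
elim: C => //= f i a D IH; congr Fun; apply/ffunP=> j.
by rewrite !ffunE; case: eqP => // _; rewrite ffunE.
Qed.

Lemma subst_ctx_comp tau sg C :
  subst_ctx tau (subst_ctx sg C) = subst_ctx (fun x => subst tau (sg x)) C.
Proof.
elim: C => //= f i a D ->; congr CFun; apply/ffunP=> j; by rewrite !ffunE subst_comp.
Qed.

Lemma eq_subst_ctx sg1 sg2 C : sg1 =1 sg2 -> subst_ctx sg1 C = subst_ctx sg2 C.
Proof.
move=> e; elim: C => //= f i a D ->; congr CFun; apply/ffunP=> j.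
by rewrite !ffunE; apply: eq_subst => x _.
Qed.

(** An instance of a hypothesis is a hypothesis of the instantiated multiset, and an instance of a
    rule application is an application of the same rule under the composed substitution. *)
Lemma judgements_subst R tau :
  (forall G i s t, conv R G i s t -> conv R (subst_eqs tau G) i (subst tau s) (subst tau t)) /\
  (forall G i s t, step R G i s t -> step R (subst_eqs tau G) i (subst tau s) (subst tau t)) /\
  (forall G i us vs, convs R G i us vs ->
     convs R (subst_eqs tau G) i (map (subst tau) us) (map (subst tau) vs)).
Proof.
have pcat G G1 G2 : perm_eq G (G1 ++ G2) ->
    perm_eq (subst_eqs tau G) (subst_eqs tau G1 ++ subst_eqs tau G2).
  by rewrite /subst_eqs -map_cat; exact: perm_map.
apply: (@conv_mutind _ _ R
  (fun G i s t => conv R (subst_eqs tau G) i (subst tau s) (subst tau t))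
  (fun G i s t => step R (subst_eqs tau G) i (subst tau s) (subst tau t))
  (fun G i us vs => convs R (subst_eqs tau G) i (map (subst tau) us) (map (subst tau) vs))).
- by move=> G G' u v /pcat p; apply: conv_hyp p.
- by move=> *; apply: conv_refl.
- by move=> G i s t _; apply: conv_sym.
- by move=> G G1 G2 i j s t u /pcat p _ h1 _ h2; apply: conv_trans p h1 h2.
- by move=> G i s t C _ h; rewrite !subst_plug; apply: conv_ctx.
- by move=> G i s t _; apply: conv_step.
- move=> G i rho sg C rR _ h; rewrite !subst_plug !subst_comp; apply: step_rule => //.
  rewrite -!map_comp in h.
  by congr convs: h; apply: eq_map => e /=; rewrite subst_comp.
- exact: convs_nil.
- by move=> G G1 G2 i j u v us vs /pcat p _ h1 _ h2; apply: convs_cons p h1 h2.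
Qed.

Lemma ccp_joinable_subst R tau G s t : ccp_joinable R G s t ->
  ccp_joinable R (subst_eqs tau G) (subst tau s) (subst tau t).
Proof.
have [hc [hs _]] := judgements_subst R tau.
have sc G' i j s' t' : step_conv R G' i j s' t' ->
    step_conv R (subst_eqs tau G') i j (subst tau s') (subst tau t').
  case=> w [G1 [G2 [p /hs h1 /hc h2]]]; exists (subst tau w), (subst_eqs tau G1), (subst_eqs tau G2).
  by split=> //; rewrite /subst_eqs -map_cat; exact: perm_map.
case=> [[/hc h|/hc h]|[/hs h|/hs h]|[[i [j [ij /sc h1]]] [i' [j' [ij' /sc h2]]]]].
- by apply: Or31; left.
- by apply: Or31; right.
- by apply: Or32; left.
- by apply: Or32; right.
by apply: Or33; split; [exists i, j | exists i', j'].
Qed.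

(** Passing through [raw] removes the dependence of the argument type on [f]. *)
Lemma Fun_inj f (a a' : {ffun 'I_(ar f) -> term ar}) : Fun f a = Fun f a' -> a = a'.
Proof.
move/(congr1 (@raw F ar)) => [/eq_in_map h]; apply/ffunP=> i; apply: (@raw_inj F ar).
exact: (h i (mem_enum _ i)).
Qed.

Definition solves (todo : seq (equation ar)) b tau : Prop :=
  (forall e : equation ar, e \in todo -> subst tau e.1 = subst tau e.2) /\
  (forall p, p \in b -> tau p.1 = subst tau p.2).

(** Bound variables count as occurrences too. As a multiset this is invariant under [ustep], so
    variables that are distinct at the start remain so, and a bound variable occurs nowhere else. *)
Definition state_vars (todo : seq (equation ar)) b : seq nat :=
  flatten [seq vars e.1 ++ vars e.2 | e <- todo] ++ flatten [seq p.1 :: vars p.2 | p <- b].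

(** Termination measure: every successful [ustep] removes at least one node on a left side, which is
    why [unify] iterates [rsize s] times. *)
Definition todo_size (todo : seq (equation ar)) : nat := sumn [seq rsize (raw e.1) | e <- todo].

Lemma solves_bind x u e rest b tau : e = (Var x, u) \/ e = (u, Var x) ->
  solves rest ((x, u) :: b) tau <-> solves (e :: rest) b tau.
Proof.
move=> eE; have eQ : subst tau e.1 = subst tau e.2 <-> tau x = subst tau u.
  by case: eE => -> /=; split.
split=> -[h1 h2]; split.
- by move=> d; rewrite inE => /orP[/eqP->|/h1//]; apply/eQ/(h2 (x, u))/mem_head.
- by move=> p pb; apply: h2; rewrite inE pb orbT.
- by move=> d dr; apply: h1; rewrite inE dr orbT.
- by move=> p; rewrite inE => /orP[/eqP->|/h2//]; apply/eQ/h1/mem_head.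
Qed.

Lemma state_vars_cons e rest b :
  state_vars (e :: rest) b = (vars e.1 ++ vars e.2) ++ state_vars rest b.
Proof. by rewrite /state_vars /= catA. Qed.

Lemma ustep_cons e rest b :
  (exists todo' b',
     [/\ ustep (raw_eqs (e :: rest)) (raw_binds b) = [:: (raw_eqs todo', raw_binds b')],
         forall tau, solves todo' b' tau <-> solves (e :: rest) b tau,
         perm_eq (state_vars todo' b') (state_vars (e :: rest) b)
       & todo_size todo' < todo_size (e :: rest)])
  \/ ustep (raw_eqs (e :: rest)) (raw_binds b) = [::]
     /\ forall tau, ~ solves (e :: rest) b tau.
Proof.
case: e => -[x|f a] u.
  left; exists rest, ((x, u) :: b); split=> //.
  - by move=> tau; apply: solves_bind; left.
  - by rewrite /state_vars /=; perm_count.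
case: u => [y|g a'].
  left; exists rest, ((y, Fun f a) :: b); split=> //.
  - by move=> tau; apply: solves_bind; right.
  - by rewrite /state_vars /=; perm_count.
  - by rewrite /todo_size /= rsize_Fun; lia.
rewrite /ustep /=.
have argsE (h : F) (c : {ffun 'I_(ar h) -> term ar}) :
    rargs (raw (Fun h c)) = [seq raw (c i) | i <- enum 'I_(ar h)].
  by rewrite /= /rargs /= -map_comp map_id.
have sizeE (h : F) (c : {ffun 'I_(ar h) -> term ar}) : size (rargs (raw (Fun h c))) = ar h.
  by rewrite argsE size_map size_enum_ord.
rewrite -/(raw (Fun f a)) -/(raw (Fun g a')) !sizeE !argsE.
(* Over a signature equal symbols have equal arities, so the only failure is a clash of root
   symbols. *)
have [fg|fg] := eqVneq (rsym (raw (Fun f a))) (rsym (raw (Fun g a'))); last first.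
  right; split=> // tau [/(_ _ (mem_head _ _)) /= E _].
  by case/eqP: fg; exact: (congr1 (fun t => rsym (raw t)) E).
have {}fg : f = g by exact: (pcan_inj pickleK).
case: g / fg a' => a'; rewrite eqxx /=; left.
pose es := [seq (a i, a' i) | i <- enum 'I_(ar f)].
exists (es ++ rest), b; split.
- congr [:: (_, _)]; rewrite /raw_eqs map_cat; congr (_ ++ _).
  apply: (@eq_from_nth _ (RV 0, RV 0)).
    by rewrite size_map size_iota /es -map_comp size_map size_enum_ord.
  move=> i; rewrite size_map size_iota => ilt.
  pose o := Ordinal ilt.
  rewrite (nth_map 0) ?size_iota // nth_iota // add0n.
  have nthE (T : Type) (x : T) (h : 'I_(ar f) -> T) : nth x [seq h j | j <- enum 'I_(ar f)] i = h o.
    by rewrite (nth_map o) ?size_enum_ord // -[i]/(nat_of_ord o) nth_ord_enum.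
  by rewrite /es -map_comp !nthE.
- move=> tau; split=> -[h1 h2]; split=> //.
    move=> d; rewrite inE => /orP[/eqP->|dr]; last by apply: h1; rewrite mem_cat dr orbT.
    rewrite /=; congr Fun; apply/ffunP=> i; rewrite !ffunE.
    by apply: (h1 (a i, a' i)); rewrite mem_cat map_f // mem_enum.
  move=> d; rewrite mem_cat => /orP[/mapP[i _ ->]|dr]; last by apply: h1; rewrite inE dr orbT.
  have /Fun_inj/ffunP/(_ i) := h1 _ (mem_head _ _); by rewrite !ffunE.
- have pe is_ : perm_eq (flatten [seq vars (a i) ++ vars (a' i) | i <- is_])
      (flatten [seq vars (a i) | i <- is_] ++ flatten [seq vars (a' i) | i <- is_]).
    by elim: is_ => //= i is_ IH; perm_count.
  have {pe} p := pe (enum 'I_(ar f)); rewrite state_vars_cons /state_vars map_cat flatten_cat.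
  have -> : [seq vars e.1 ++ vars e.2 | e <- es] =
      [seq vars (a i) ++ vars (a' i) | i <- enum 'I_(ar f)].
    by rewrite /es -map_comp.
  by perm_count.
- rewrite /todo_size map_cat sumn_cat /= rsize_Fun /es -!map_comp.
  by rewrite addSn ltnS.
Qed.

Lemma unify_iter n todo b : todo_size todo <= n ->
  let res := iter n (fun sts => flatten [seq ustep st.1 st.2 | st <- sts])
               [:: (raw_eqs todo, raw_binds b)] in
  (exists b', [/\ res = [:: ([::], raw_binds b')],
     forall tau, solves [::] b' tau <-> solves todo b tau
     & perm_eq (state_vars [::] b') (state_vars todo b)])
  \/ res = [::] /\ forall tau, ~ solves todo b tau.
Proof.
elim: n todo b => [|n IH] [|e rest] b sz.
- by left; exists b.
- by case: e sz => -[x|f a] u; rewrite /todo_size /= ?rsize_Fun.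
- rewrite iterSr; apply: (IH [::] b); exact: leq0n.
rewrite iterSr [flatten _]/= cats0 => res.
case: (ustep_cons e rest b) => [[todo' [b' [E sol pv lt]]]|[E nosol]]; rewrite /res E.
  have [|[b2 [E2 sol2 pv2]]|[E2 nosol]] := IH todo' b'; first by lia.
    left; exists b2; split=> //; last exact: perm_trans pv2 pv.
    by move=> tau; rewrite sol2 sol.
  by right; split=> // tau /sol; exact: nosol.
by right; split=> //; elim: (n) => //= m ->.
Qed.

(** No bound variable occurs in a bound term, so plain lookup already solves all bindings. The last
    clause is most generality in idempotent form: each unifier [tau] factors through the lookup with
    [tau] itself as the second factor. *)
Lemma unify_spec s t : uniq (vars s ++ vars t) ->
  (exists b, [/\ unify (raw s) (raw t) = [:: ([::], raw_binds b)],
     subst (tlookup b) s = subst (tlookup b) t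
     & forall tau, subst tau s = subst tau t -> forall x, tau x = subst tau (tlookup b x)])
  \/ unify (raw s) (raw t) = [::] /\ forall tau, subst tau s <> subst tau t.
Proof.
move=> us; have solE tau : solves [:: (s, t)] [::] tau <-> subst tau s = subst tau t.
  by split=> [[/(_ _ (mem_head _ _))]|h] //; split=> // e; rewrite mem_seq1 => /eqP->.
have sz : todo_size [:: (s, t)] <= rsize (raw s) by rewrite /todo_size /= addn0.
have [[b [E sol pv]]|[E nosol]] := unify_iter [::] sz; last first.
  by right; split=> // tau /solE; exact: nosol.
left; exists b; split=> //.
  apply/solE/sol; split=> // p pb.
  have : uniq (state_vars [::] b) by rewrite (perm_uniq pv) /state_vars /= !cats0.
  rewrite /state_vars /=; case/splitPr: b / pb {E sol pv} => b1 b2.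
  rewrite map_cat flatten_cat /= => ub.
  have dom b' x : x \in unzip1 b' -> x \in flatten [seq q.1 :: vars q.2 | q <- b'].
    by case/mapP=> q qb ->; apply/flattenP; exists (q.1 :: vars q.2);
      rewrite ?mem_head //; apply: map_f qb.
  have notdom x : x \in p.1 :: vars p.2 -> x \notin unzip1 b1 /\ x \notin unzip1 b2.
    move=> xp; move: ub; rewrite cat_uniq -cat_cons cat_uniq.
    move=> /and3P[_ /hasPn h1 /and3P[_ /hasPn h2 _]].
    split; apply/negP=> /dom xb; last by have := h2 _ xb; rewrite /= xp.
    by have := h1 x; rewrite mem_cat xp /= xb => /(_ isT).
  have -> : tlookup (b1 ++ p :: b2) p.1 = p.2.
    by rewrite tlookup_cat (negPf (notdom _ (mem_head _ _)).1) /= eqxx.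
  (* No variable of [p.2] is bound, hence the lookup acts on [p.2] as the identity. *)
  rewrite -[LHS](_ : subst (fun x => Var x) p.2 = _).
    apply: eq_subst => x xp; have xin : x \in p.1 :: vars p.2 by rewrite inE xp orbT.
    have [n1 n2] := notdom x xin; rewrite tlookup_cat (negPf n1) /=.
    case: eqP => [px|_].
      move: ub; rewrite cat_uniq /= => /and3P[_ _ /andP[]].
      by rewrite px mem_cat xp.
    by rewrite -[b2]cats0 tlookup_cat (negPf n2).
  elim/term_ffun_ind: (p.2) => //= f a IH; congr Fun; apply/ffunP=> i; by rewrite ffunE.
move=> tau /solE/sol[_ h] x; have [xb|xb] := boolP (x \in unzip1 b).
  case/mapP: xb => p pb ->; elim: b h pb {E sol pv} => //= -[y u] b IH h pb.
  case: eqP => [<-|yp]; first exact: (h (y, u) (mem_head _ _)).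
  move: pb; rewrite inE => /orP[/eqP pE|pb]; first by rewrite pE in yp.
  by apply: IH => // q qb; apply: h; rewrite inE qb orbT.
by rewrite -[b]cats0 tlookup_cat (negPf xb).
Qed.

End CriticalPairs.

(** * Reduction to canonical critical pairs and the decision theorem *)

Section Decision.
Variables (F : countType) (ar : F -> nat).
Implicit Types (s t u : term ar) (G : seq (equation ar)) (C : ctx ar)
  (rho : rule ar) (tau sg : nat -> term ar) (d : nat -> nat).

Fixpoint ctx_path C : seq nat :=
  match C with Hole => [::] | CFun f i a D => (i : nat) :: ctx_path D end.

Lemma subterm_at_plug C u : subterm_at (plug C u) (ctx_path C) = Some u.
Proof. by elim: C => [|f i a D IH] /=; [case: u | rewrite valK ffunE eqxx]. Qed.

Lemma replace_at_plug C u v : replace_at (plug C u) (ctx_path C) v = plug C v.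
Proof.
elim: C => [|f i a D IH] /=; first by case: u.
congr Fun; apply/ffunP=> j; rewrite !ffunE.
by rewrite (inj_eq val_inj); case: eqP.
Qed.

Lemma ctx_path_subst sg C : ctx_path (subst_ctx sg C) = ctx_path C.
Proof. by elim: C => //= f i a D ->. Qed.

Lemma size_raw_ctx C : size (raw_ctx C) = size (ctx_path C).
Proof. by elim: C => //= f i a D ->. Qed.

Lemma subterm_at_ctx t p u : subterm_at t p = Some u ->
  exists2 C, t = plug C u & ctx_path C = p.
Proof.
elim: p t => [|i p IH] [x|f a] //=; [by move=> [<-]; exists (Hole ar) ..|].
case: insubP => // j _ ji /IH[C aE pE]; exists (CFun j a C); last by rewrite /= pE ji.
rewrite /=; congr Fun; apply/ffunP=> k; rewrite ffunE; case: eqP => // ->.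
exact: aE.
Qed.

Lemma subterm_at_rename d t p :
  subterm_at (subst (rename ar d) t) p = omap (subst (rename ar d)) (subterm_at t p).
Proof.
elim: p t => [|i p IH] [x|f a] //=.
by case: insubP => // j _ _; rewrite ffunE IH.
Qed.

Lemma is_var_raw t : ris_var (raw t) = is_var t.
Proof. by case: t. Qed.

Lemma is_var_rename d t : is_var (subst (rename ar d) t) = is_var t.
Proof. by case: t. Qed.

Lemma vars_rename d t : vars (subst (rename ar d) t) = map d (vars t).
Proof.
elim/term_ffun_ind: t => //= f a IH; rewrite map_flatten -map_comp.
by congr flatten; apply: eq_map => i; rewrite /= ffunE IH.
Qed.

Lemma rule_vars_rename d rho : rule_vars (rename_rule d rho) = map d (rule_vars rho).
Proof.
rewrite /rule_vars /= !vars_rename !map_cat map_flatten /subst_eqs -!map_comp.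
by congr (_ ++ (_ ++ flatten _)); apply: eq_map => e /=; rewrite !vars_rename map_cat.
Qed.

Lemma uniq_vars_plug C u : uniq (vars (plug C u)) ->
  uniq (vars u) /\ {subset vars u <= vars (plug C u)}.
Proof.
elim: C => [|f i a D IH] /=; first by split.
set b := [ffun _ => _] => ub.
have bi : b i = plug D u by rewrite ffunE eqxx.
have sub : {subset vars (plug D u) <= flatten [seq vars (b j) | j <- enum 'I_(ar f)]}.
  move=> x xD; apply/flattenP; exists (vars (b i)); last by rewrite bi.
  by apply: (map_f (fun j => vars (b j))); rewrite mem_enum.
have [u1 u2] : uniq (vars u) /\ {subset vars u <= vars (plug D u)}.
  move: ub; rewrite (enum_split i) map_cat flatten_cat /= bi !cat_uniq.
  by case/and3P=> _ _ /and3P[/IH].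
by split=> // x /u2 /sub.
Qed.

Lemma enc_raw_cond (c : equation ar) : enc (raw c.1, (raw c.2, tt)) = code_equation c.
Proof. by rewrite !enc_cons_pair !enc_raw /code_equation !code_P. Qed.

Lemma enc_raw_rule rho : enc (raw_rule rho) = code_rule rho.
Proof.
rewrite /raw_rule !enc_cons_pair !enc_raw /code_rule !code_P; congr (P _ (P _ (P _ _))).
rewrite /raw_conds /enc /enc_seq -map_comp; congr CodeSeq.code.
by apply: eq_map => c; exact: enc_raw_cond.
Qed.

Lemma code_rule_inj : injective (@code_rule F ar).
Proof.
move=> [l r cs] [l' r' cs'] /(can_inj CodeSeq.codeK) /= [/code_term_inj-> /code_term_inj->].
move/(can_inj CodeSeq.codeK)/inj_map => -> // e e' /(can_inj CodeSeq.codeK) [].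
by case: e e' => e1 e2 [e1' e2'] /= /code_term_inj-> /code_term_inj->.
Qed.

Definition parity_copy (o : bool) (x : nat) : nat := o + (x + x).

Lemma parity_copy_inj o : injective (parity_copy o).
Proof. by rewrite /parity_copy => x y; lia. Qed.

Lemma rrename_raw o t : rrename o (raw t) = raw (subst (rename ar (parity_copy o)) t).
Proof. by rewrite raw_subst. Qed.

Variable R : ctrs ar.
Hypothesis lrR : lr_separated R.

Definition copy1 rho := rename_rule (parity_copy false) rho.
Definition copy2 rho := rename_rule (parity_copy true) rho.

Lemma copies_disjoint rho1 rho2 z :
  ~~ ((z \in rule_vars (copy1 rho1)) && (z \in rule_vars (copy2 rho2))).
Proof.
rewrite !rule_vars_rename; apply/negP => /andP[/mapP[x _ ->] /mapP[y _]].
by rewrite /parity_copy; lia.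
Qed.

Lemma copies_uniq rho1 rho2 C u : rho1 \in R -> rho2 \in R ->
  lhs (copy2 rho2) = plug C u -> uniq (vars (lhs (copy1 rho1)) ++ vars u).
Proof.
have lin o rho : rho \in R -> uniq (vars (subst (rename ar (parity_copy o)) (lhs rho))).
  move=> /lrR[xys [_ /andP[l _] _ _ _]].
  by rewrite vars_rename (map_inj_uniq (@parity_copy_inj o)).
move=> r1 r2 lE; rewrite cat_uniq lin //=.
have := lin true _ r2; rewrite [subst _ _]lE => /uniq_vars_plug[-> sub].
rewrite andbT; apply/hasPn => z /sub; rewrite -lE => z2.
have := copies_disjoint rho1 rho2 z; rewrite /rule_vars [z \in vars (lhs (copy2 _)) ++ _]mem_cat z2.
by rewrite andbT mem_cat negb_or => /andP[].
Qed.

Lemma raw_cp_eqs b rho1 rho2 :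
  [seq (rsubst (lookup (raw_binds b)) (rrename false c.1),
        rsubst (lookup (raw_binds b)) (rrename false c.2.1)) | c <- (raw_rule rho1).2.2.1] ++
  [seq (rsubst (lookup (raw_binds b)) (rrename true c.1),
        rsubst (lookup (raw_binds b)) (rrename true c.2.1)) | c <- (raw_rule rho2).2.2.1] =
  raw_eqs (subst_eqs (tlookup b) (conds (copy1 rho1)) ++ subst_eqs (tlookup b) (conds (copy2 rho2))).
Proof.
rewrite /raw_eqs /raw_rule /raw_conds /subst_eqs map_cat /= -!map_comp.
by congr (_ ++ _); apply: eq_map => c /=; rewrite !rrename_raw !rsubst_lookup.
Qed.

Lemma overlap_okP rho1 rho2 C b :
  reflect (ccp_joinable R
       (subst_eqs (tlookup b) (conds (copy1 rho1)) ++ subst_eqs (tlookup b) (conds (copy2 rho2)))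
       (subst (tlookup b) (plug C (rhs (copy1 rho1)))) (subst (tlookup b) (rhs (copy2 rho2))))
    (overlap_ok (map (@raw_rule F ar) R) (raw_rule rho1) (raw_rule rho2)
       (raw_ctx C) (raw_binds b)).
Proof.
rewrite /overlap_ok raw_cp_eqs [(raw_rule rho1).2.1]/= [(raw_rule rho2).2.1]/=.
rewrite !rrename_raw -raw_plug !rsubst_lookup; exact: joinablebP.
Qed.

Lemma critical_pairs_okP rho1 rho2 : rho1 \in R -> rho2 \in R ->
  critical_pairs_ok (map (@raw_rule F ar) R) (raw_rule rho1) (raw_rule rho2) <->
  (forall C u b, lhs (copy2 rho2) = plug C u -> ~~ is_var u ->
     ~ (ctx_path C = [::] /\ rho1 = rho2) ->
     unify (raw (lhs (copy1 rho1))) (raw u) = [:: ([::], raw_binds b)] ->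
     ccp_joinable R
       (subst_eqs (tlookup b) (conds (copy1 rho1)) ++ subst_eqs (tlookup b) (conds (copy2 rho2)))
       (subst (tlookup b) (plug C (rhs (copy1 rho1)))) (subst (tlookup b) (rhs (copy2 rho2)))).
Proof.
move=> r1 r2; rewrite /critical_pairs_ok !enc_raw_rule (inj_eq code_rule_inj).
have l1 : rrename false (raw_rule rho1).1 = raw (lhs (copy1 rho1)) by exact: rrename_raw.
have l2 : rrename true (raw_rule rho2).1 = raw (lhs (copy2 rho2)) by exact: rrename_raw.
rewrite {}l1 {}l2; split=> [/allP h C u b lE nv np ub|h].
  have m : (raw_ctx C, raw u) \in decs (raw (lhs (copy2 rho2))) by rewrite lE mem_raw_decs.
  move: (h _ m); cbn [fst snd].
  rewrite is_var_raw (negPf nv) size_raw_ctx size_eq0 ub orFb all_seq1 /=.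
  case/orP=> [/andP[/eqP pE /eqP rE]|/overlap_okP //]; first by case: np.
apply/allP=> dd /raw_decsP[C [u [-> lE]]]; cbn [fst snd]; rewrite is_var_raw.
case nv: (is_var u) => //; rewrite orFb size_raw_ctx size_eq0.
case np: (_ && _) => //; rewrite orFb.
have [[b [ub _ _]]|[-> //]] := unify_spec (copies_uniq r1 r2 lE).
rewrite ub all_seq1; apply/overlap_okP; apply: (h C u b) => //; first by rewrite nv.
by case=> p0 r0; rewrite p0 r0 !eqxx in np.
Qed.

Lemma canonical_ccp : ccp_condition R <->
  forall rho1 rho2, rho1 \in R -> rho2 \in R ->
  forall C u b, lhs (copy2 rho2) = plug C u -> ~~ is_var u ->
     ~ (ctx_path C = [::] /\ rho1 = rho2) ->
     unify (raw (lhs (copy1 rho1))) (raw u) = [:: ([::], raw_binds b)] ->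
     ccp_joinable R
       (subst_eqs (tlookup b) (conds (copy1 rho1)) ++ subst_eqs (tlookup b) (conds (copy2 rho2)))
       (subst (tlookup b) (plug C (rhs (copy1 rho1)))) (subst (tlookup b) (rhs (copy2 rho2))).
Proof.
split=> [h rho1 rho2 r1 r2 C u b lE nv np ub|h G s t].
  apply: h; rewrite -(replace_at_plug C u) -lE.
  apply: (CCP (u := u)) => //; try exact: parity_copy_inj.
  - exact: copies_disjoint.
  - by rewrite -/(copy2 rho2) lE subterm_at_plug.
  have [[b' [ub' eqb mgb]]|[]] := unify_spec (copies_uniq r1 r2 lE); last by rewrite ub.
  have bb x : tlookup b x = tlookup b' x.
    by apply: (@raw_inj F ar); rewrite -!lookup_raw; move: ub'; rewrite ub => -[->].
  split; first by rewrite !(@eq_subst _ _ (tlookup b) (tlookup b')).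
  by move=> tau /mgb hx; exists tau => x; rewrite hx bb.
case=> {G s t} rho1 rho2 d1 d2 p u sg r1 r2 inj1 inj2 v1 v2 disj pE nv [unif _] np.
move: pE; rewrite /v2 /= subterm_at_rename.
case pE: (subterm_at _ _) => [u0|//] [uE]; rewrite -{}uE in nv unif *.
(* The overlap is located in the unrenamed rule, from where it is carried to both renamings: the
   given [d2] and the canonical odd copy. *)
have [C lE pC] := subterm_at_ctx pE.
(* Undoes the canonical renaming and then applies [d1] or [d2], followed by [sg]. The parity tells
   which rule a variable belongs to, so one substitution serves both rules. *)
pose tau n := if odd n then sg (d2 n./2) else sg (d1 n./2).
have tau1 x : subst tau (rename ar (parity_copy false) x) = subst sg (rename ar d1 x).
  by rewrite /= /tau /parity_copy addnn odd_double doubleK.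
have tau2 x : subst tau (rename ar (parity_copy true) x) = subst sg (rename ar d2 x).
  by rewrite /= /tau /parity_copy addnn /= odd_double /= uphalf_double.
pose C' := subst_ctx (rename ar (parity_copy true)) C.
pose u' := subst (rename ar (parity_copy true)) u0.
have lE' : lhs (copy2 rho2) = plug C' u' by rewrite /= lE subst_plug.
have e1 t : subst tau (subst (rename ar (parity_copy false)) t) = subst sg (subst (rename ar d1) t).
  by rewrite !subst_comp; apply: eq_subst => x _; exact: tau1.
have e2 t : subst tau (subst (rename ar (parity_copy true)) t) = subst sg (subst (rename ar d2) t).
  by rewrite !subst_comp; apply: eq_subst => x _; exact: tau2.
have e3 : subst_ctx tau C' = subst_ctx sg (subst_ctx (rename ar d2) C).
  by rewrite !subst_ctx_comp; exact: eq_subst_ctx.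
have unif' : subst tau (lhs (copy1 rho1)) = subst tau u' by rewrite /= e1 e2.
have nv' : ~~ is_var u' by rewrite is_var_rename -(is_var_rename d2).
have np' : ~ (ctx_path C' = [::] /\ rho1 = rho2) by rewrite ctx_path_subst pC.
have [[b [ub _ mgb]]|[_ /(_ tau)//]] := unify_spec (copies_uniq r1 r2 lE').
(* As [tau] unifies the canonical overlap, it absorbs the canonical unifier; the given critical pair
   is therefore the [tau]-instance of the canonical one. *)
have sub_b t : subst tau (subst (tlookup b) t) = subst tau t.
  by rewrite subst_comp; apply: eq_subst => x _; rewrite -(mgb _ unif').
have := ccp_joinable_subst tau (h rho1 rho2 r1 r2 C' u' b lE' nv' np' ub).
rewrite !sub_b subst_plug e3 /subst_eqs map_cat /copy1 /copy2 /= -!map_comp.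
rewrite /v1 /v2 /= !e1 e2 lE subst_plug -pC -(ctx_path_subst (rename ar d2) C) replace_at_plug.
rewrite subst_plug; congr ccp_joinable; congr (_ ++ _);
  by apply: eq_map => c; rewrite /= !sub_b ?e1 ?e2.
Qed.

Lemma decidebP : decideb (map (@raw_rule F ar) R) <-> ccp_condition R.
Proof.
rewrite canonical_ccp; split=> [/allP h rho1 rho2 r1 r2|h].
  apply/(critical_pairs_okP r1 r2).
  by have /allP := h _ (map_f (@raw_rule F ar) r1); apply; exact: map_f.
apply/allP=> _ /mapP[rho1 r1 ->]; apply/allP=> _ /mapP[rho2 r2 ->].
by apply/(critical_pairs_okP r1 r2)/h.
Qed.

Lemma enc_raw_rules : enc (map (@raw_rule F ar) R) = code_ctrs R.
Proof.
rewrite /enc /enc_seq -map_comp /code_ctrs; congr CodeSeq.code.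
by apply: eq_map => rho; exact: enc_raw_rule.
Qed.

End Decision.

Theorem theorem4 :
  exists decide : 1.-tuple nat -> nat,
    recursive decide /\
    forall (F : countType) (ar : F -> nat) (R : ctrs ar),
      lr_separated R -> non_duplicating R ->
      (ccp_condition R -> decide [tuple code_ctrs R] = 1) /\
      (~ ccp_condition R -> decide [tuple code_ctrs R] = 0).
Proof.
have [g gr gE] := c_decideb (c_id (A := seq rrule)).
exists (fun v => g (tnth v ord0)); split=> // F ar R lrR _.
(* Since the embedding preserves codes, [g] can be run directly on [code_ctrs R]. *)
have -> : g (tnth [tuple code_ctrs R] ord0) = decideb (map (@raw_rule F ar) R).
  by rewrite -enc_raw_rules (tnth_nth 0) /= -gE.
by split=> [/(decidebP lrR)->|h] //; case: (boolP (decideb _)) => // /(decidebP lrR).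
Qed.
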